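(* Let $N<\infty$ and let $(g_{\gamma_1})_{\gamma_1\in[0,1]}$ be a one-parameter family of noise functions with finitely many non-zero Fourier coefficients, $$ g_{\gamma_1}(x)=1+2\gamma_1\cos x+2\sum_{k=2}^{N}\gamma_k(\gamma_1)\cos kx,\qquad x\in(-\pi,\pi], $$ where the functions $\gamma_1\in[0,1]\mapsto\gamma_k(\gamma_1)\in[-1,1]$, $2\le k\le N$, are $C^2$ and $\gamma_2(\gamma_1)>0$. Consider, in the Maxwellian case, the associated dynamical system for the Fourier coefficients of even densities $f=1+2\sum_{k\ge1}a_k\cos kx$ (so $a_0=1$): $$ \frac{d}{dt}a_k = -a_k+2\gamma_k\Gamma(k/2)a_k+\gamma_k\sum_{n=1}^{k-1}\Gamma(n-k/2)a_na_{k-n}+2\gamma_k\sum_{n=k+1}^{\infty}\Gamma(n-k/2)a_na_{n-k},\qquad k\ge1, $$ with $\gamma_k=\gamma_k(\gamma_1)$ for $2\le k\le N$, $\gamma_k=0$ for $k>N$, and $\Gamma(u)=\frac{\sin(\pi u)}{\pi u}$ ($\Gamma(0)=1$). Then: (i) The uniform distribution, with Fourier coefficients $a_0=1$, $a_k=0$ ($k\ge1$), is stationary. It is (linearly) stable for $\gamma_1<\pi/4$ and unstable for $\gamma_1>\pi/4$. (ii) There is $\gamma_{max}>\pi/4$ such that for every $\gamma_1$ in the interval $\frac\pi4<\gamma_1<\gamma_{max}$ there is another invariant (stationary) solution of the dynamic problem, with Fourier coefficients $a_0=1$, $$ a_1=\sqrt{\frac{12(\gamma_1-\pi/4)}{\pi\,\gamma_2(\pi/4)}}+\mathcal{O}\big((\gamma_1-\pi/4)^{3/2}\big),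 $$ some coefficients $a_2,\dots,a_N$, and $a_k=0$ for $k>N$. (iii) This solution is linearly stable, with leading eigenvalue $$ \lambda(\gamma_1)=1-\frac8\pi\Big(\gamma_1-\frac\pi4\Big)+\mathcal{O}\big((\gamma_1-\pi/4)^{3/2}\big). $$ Here the $\mathcal{O}$ terms refer to $\gamma_1\to\pi/4$ from above.
   Context: The system is the Fourier form of the Boltzmann equation on the circle $$ \partial_t f(t,x)=\int_{-\pi}^{\pi}\int_{-\pi}^{\pi}\Big(f(t,x')f(t,x'+y)g\big(x-x'-\tfrac y2\big)-f(t,x)f(t,x+y)\Big)\frac{dx'}{2\pi}\frac{dy}{2\pi} $$ (Maxwellian case), for even $2\pi$-periodic $f$, with $a_k=\int_{-\pi}^{\pi}f(x)e^{-ikx}\frac{dx}{2\pi}$ and $\gamma_k=\frac1{2\pi}\int_{-\pi}^{\pi}g(z)e^{-ikz}dz$. (The function $g_{\gamma_1}$ is a probability density with respect to $\frac{dx}{2\pi}$ as soon as $g_{\gamma_1}\ge0$.) A stationary solution is a sequence $(a_k)$ for which the right-hand side of the system vanishes for all $k\ge1$; since $\gamma_k=0$ for $k>N$, it satisfies $a_k=0$ for $k>N$. Stability in (i): linearizing at the uniform distribution gives $\frac{d}{dt}b_k=\lambda_kb_k$ with $\lambda_k=2\gamma_k\Gamma(k/2)-1$, $k\geq1$; the uniform distribution is stable if $\lambda_k\le0$ for all $k\ge1$ and unstable otherwise. Stability in (iii): write the system restricted to $\mathbf a=(a_1,\dots,a_N)$ (with $a_k=0$ for $k>N$) as $\frac{d}{dt}\mathbf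 a=Q(\gamma_1:\mathbf a)-\mathbf a$, where $Q_k(\gamma_1:\mathbf a)=2\gamma_k\Gamma(k/2)a_k+\gamma_k\sum_{n=1}^{k-1}\Gamma(n-k/2)a_na_{k-n}+2\gamma_k\sum_{n=k+1}^{N}\Gamma(n-k/2)a_na_{n-k}$. A stationary point $\bar{\mathbf a}(\gamma_1)$ is linearly stable if all eigenvalues of the Jacobian matrix $\frac{\partial}{\partial\mathbf a}Q(\gamma_1:\bar{\mathbf a}(\gamma_1))$ lie inside the (open) unit disc; the leading eigenvalue $\lambda(\gamma_1)$ is the eigenvalue of this Jacobian of largest modulus (the one tending to $1$ as $\gamma_1\to\pi/4$). *)

(* Defs.v *)
From HB Require Import structures.
From mathcomp Require Import all_boot all_order all_algebra complex.
From mathcomp Require Import all_classical all_reals all_analysis.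

Set Implicit Arguments.
Unset Strict Implicit.
Unset Printing Implicit Defensive.

Import Order.TTheory GRing.Theory Num.Theory.
Import numFieldNormedType.Exports.

Local Open Scope classical_set_scope.
Local Open Scope ring_scope.

Section Calculus.
Variable R : realType.
Implicit Types f : R -> R.

(* The increments h are restricted so that x + h stays in [a, b]: the
   derivatives at the end points are the one-sided ones. *)
Definition deriv_on (a b : R) f f' : Prop :=
  forall x, a <= x <= b ->
    h^-1 * (f (x + h) - f x) @[h --> within [set h | a <= x + h <= b] 0^']
      --> f' x.

Definition C2_on (a b : R) f : Prop :=
  exists f' f'' : R -> R,
    [/\ deriv_on a b f f', deriv_on a b f' f''
      & {within `[a, b], continuous f''}].

End Calculus.

Section Boltzmann.
Variable R : realType.

Definition Gam (u : R) : R := if u == 0 then 1 else sin (pi * u) / (pi * u).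

(* Noise coefficients k |-> gamma_k for the parameter value g1 = gamma_1; the
   functions gam k are used for 2 <= k <= N only.  gamma_0 = 1 is the mass of
   the noise; it does not enter the equations, which are for k >= 1. *)
Definition noise_coef (N : nat) (gam : nat -> R -> R) (g1 : R) (k : nat) : R :=
  if k == 0%N then 1
  else if k == 1%N then g1
  else if (k <= N)%N then gam k g1
  else 0.

Definition tail_term (a : nat -> R) (k n : nat) : R :=
  Gam (n%:R - k%:R / 2) * a n * a (n - k)%N.

Definition boltzmann_rhs (c a : nat -> R) (k : nat) : R :=
  - a k + 2 * c k * Gam (k%:R / 2) * a k
  + c k * (\sum_(1 <= n < k) Gam (n%:R - k%:R / 2) * a n * a (k - n)%N)
  + 2 * c k * limn (fun m => \sum_(k.+1 <= n < m) tail_term a k n).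

(* Convergence of the series is required, since limn takes an arbitrary value
   on divergent sequences. *)
Definition stationary (c a : nat -> R) : Prop :=
  a 0%N = 1 /\
  forall k, (1 <= k)%N ->
    cvgn (fun m => \sum_(k.+1 <= n < m) tail_term a k n) /\
    boltzmann_rhs c a k = 0.

Definition uniform_coef (k : nat) : R := (k == 0%N)%:R.

(* The linearization at the uniform distribution is diagonal:
   b_k' = uniform_rate c k * b_k for k >= 1. *)
Definition uniform_rate (c : nat -> R) (k : nat) : R :=
  2 * c k * Gam (k%:R / 2) - 1.

Definition uniform_stable (c : nat -> R) : Prop :=
  forall k, (1 <= k)%N -> uniform_rate c k <= 0.

Definition uniform_unstable (c : nat -> R) : Prop := ~ uniform_stable c.

(* The row vector (a_1, ..., a_N) has a_k at index k - 1. *)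
Definition trunc_vec (N : nat) (a : nat -> R) : 'rV[R]_N := \row_(i < N) a i.+1.

Definition coef_of (N : nat) (v : 'rV[R]_N) (k : nat) : R :=
  if k is j.+1 then (if insub j is Some i then v 0 i else 0) else 1.

Definition Qmap (N : nat) (c : nat -> R) (v : 'rV[R]_N) : 'rV[R]_N :=
  let a := coef_of v in
  \row_(i < N)
    let k := i.+1 in
    (2 * c k * Gam (k%:R / 2) * a k
     + c k * (\sum_(1 <= n < k) Gam (n%:R - k%:R / 2) * a n * a (k - n)%N)
     + 2 * c k * (\sum_(k.+1 <= n < N.+1) Gam (n%:R - k%:R / 2) * a n
                                          * a (n - k)%N)).

(* 'J f p acts on row vectors (it is the transpose of the matrix with entries
   df_i/dx_j), as eigenvalue does; the spectrum is taken in the complex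
   numbers. *)
Definition jacobianQ (N : nat) (c a : nat -> R) : 'M[R[i]]_N :=
  map_mx (real_complex R) ('J (@Qmap N c) (trunc_vec N a)).

Definition linearly_stable (N : nat) (c a : nat -> R) : Prop :=
  forall z : R[i], eigenvalue (jacobianQ N c a) z -> `|z| < 1.

(* Strict domination makes "the eigenvalue of largest modulus" unique. *)
Definition leading_eigenvalue (N : nat) (M : 'M[R[i]]_N) (z : R[i]) : Prop :=
  eigenvalue M z /\ forall w, eigenvalue M w -> w != z -> `|w| < `|z|.

End Boltzmann.

(* Main.v *)
Require Import Defs.
From HB Require Import structures.
From mathcomp Require Import all_boot all_order all_algebra complex.
From mathcomp Require Import all_classical all_reals all_analysis.
From mathcomp Require Import ring lra zify.

Set Implicit Arguments.
Unset Strict Implicit.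
Unset Printing Implicit Defensive.

Import Order.TTheory GRing.Theory Num.Theory.
Import numFieldNormedType.Exports.

Local Open Scope classical_set_scope.
Local Open Scope ring_scope.

(** For even [k] the interaction coefficients vanish except for one square
    term, so that [a_2 = gamma_2 a_1^2], and every mode [k >= 2] is strictly
    damped.  Fixing [a_1 = x], the modes [k >= 2] are therefore slaved to [x] by
    a contraction, with [a_k = O(x^2)] for [k >= 2] and [a_k = O(x^3)] for
    [k >= 3].  With [e = 4/pi (gamma_1 - pi/4)] the remaining equation reads
    [e x - mu x^3 + O(x^5) = 0], solved by the intermediate value theorem.

    The Jacobian at this point is an [O(x)] perturbation of a diagonal matrix
    with one entry [1 + e] and all others of modulus at most [rho < 1].  Hence
    it has an eigenvalue [lam] near [1 + e], and all other eigenvalues are of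
    modulus less than [(1 + rho) / 2 < lam].  Its eigenvector
    [(1, v_2, v_3, ...)] has [lam v_2 = 2 gamma_2 x] and [v_k = O(x^2)] for
    [k >= 3], so [lam = 1 + e - mu x^2 (1 + 2 / lam) + O(x^4)], which is
    [1 - 2 e + O(e^2)] because [mu x^2 = e + O(e^2)]. *)

(** * Matrix norms and quadratic maps *)

HB.instance Definition _ (R : realType) m n := Complete.on 'M[R]_(m, n).

Lemma mx_subE (V : zmodType) m n (A B : 'M[V]_(m, n)) i j :
  (A - B) i j = A i j - B i j.
Proof. by rewrite !mxE. Qed.

Section MatrixNorm.
Variable K : numDomainType.

Lemma ler_mx_norm_coord m n (M : 'M[K]_(m, n)) i j : `|M i j| <= `|M|.
Proof.
rewrite -[leLHS]nngE num_le.
exact: (le_bigmax _ (fun ij => `|M ij.1 ij.2|%:nng) (i, j)).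
Qed.

Lemma mx_norm_le m n (M : 'M[K]_(m, n)) (t : K) :
  0 <= t -> (forall i j, `|M i j| <= t) -> `|M| <= t.
Proof.
move=> /nonnegP[{}t] Mt; rewrite [leLHS]mx_normE num_le.
apply/bigmax_leP; split=> [|[i j] _]; rewrite -num_le /=; first exact: ge0.
exact: Mt.
Qed.

Lemma ler_mulmx_coord m n p (A : 'M[K]_(m, n)) (B : 'M[K]_(n, p)) (t : K) i k :
  \sum_j `|B j k| <= t -> `|(A *m B) i k| <= t * `|A|.
Proof.
move=> Bt; rewrite mxE; apply: le_trans (ler_norm_sum _ _ _) _.
apply: le_trans (ler_wpM2r (normr_ge0 A) Bt).
rewrite mulr_suml ler_sum // => j _.
by rewrite normrM mulrC ler_wpM2l // ler_mx_norm_coord.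
Qed.

End MatrixNorm.

Lemma mulmxr_continuous (K : numFieldType) m n p (M : 'M[K]_(n, p)) :
  continuous (fun A : 'M[K]_(m, n) => A *m M).
Proof.
apply/(linear_bounded_continuous (mulmxr M))/bounded_funP => r.
pose t := \sum_k \sum_j `|M j k|.
have t0 : 0 <= t by apply: sumr_ge0 => k _; exact: sumr_ge0.
exists (t * r) => A Ar; apply: le_trans (ler_wpM2l t0 Ar).
apply: mx_norm_le => [|i k]; first exact: mulr_ge0.
apply: ler_mulmx_coord; rewrite /t [leRHS](bigD1 k) //= lerDl.
by apply: sumr_ge0 => l _; exact: sumr_ge0.
Qed.

Lemma closed_ball_fixpoint (R : realType) (V : completeNormedModType R)
    (f : V -> V) (r q : R) :
  0 <= r -> 0 <= q < 1 -> (forall u, `|u| <= r -> `|f u| <= r) ->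
  (forall u v, `|u| <= r -> `|v| <= r -> `|f u - f v| <= q * `|u - v|) ->
  exists2 u, `|u| <= r & u = f u.
Proof.
move=> r0 /andP[q0 q1] fr f_lip; pose U := closed_ball_ Num.norm (0 : V) r.
have UE u : U u <-> `|u| <= r by rewrite /U /closed_ball_ /= sub0r normrN.
have fU : {homo f : x / U x >-> U x} by move=> u /UE/fr/UE.
have contr : is_contraction (mkfun_fun fU).
  exists (NngNum q0); split=> // -[u v] /= [/UE ur /UE vr]; exact: f_lip.
have [||u Uu uE] := banach_fixed_point contr.
- exact: closed_closed_ball_.
- by exists 0; apply/UE; rewrite normr0.
- by exists u => //; apply/UE.
Qed.

Section BilinearForms.
Variables (R : realDomainType) (n : nat).
Implicit Types (M : 'M[R]_n) (u v w : 'rV[R]_n).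

Definition l1norm M : R := \sum_(p : 'I_n * 'I_n) `|M p.1 p.2|.

Definition bform M u v : R :=
  \sum_(p : 'I_n * 'I_n) M p.1 p.2 * (u 0 p.1 * v 0 p.2).

Definition polar M u v : R := bform M u v + bform M v u.

Lemma l1norm_ge0 M : 0 <= l1norm M.
Proof. exact: sumr_ge0. Qed.

Lemma ler_l1norm M i j : `|M i j| <= l1norm M.
Proof. by rewrite /l1norm (bigD1 (i, j)) //= lerDl sumr_ge0. Qed.

Lemma bformDl M u v w : bform M (u + v) w = bform M u w + bform M v w.
Proof.
by rewrite -big_split; apply: eq_bigr => p _; rewrite mxE mulrDl mulrDr.
Qed.

Lemma bformDr M u v w : bform M w (u + v) = bform M w u + bform M w v.
Proof. by rewrite -big_split; apply: eq_bigr => p _; rewrite mxE !mulrDr. Qed.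

Lemma bform0 M : bform M 0 0 = 0.
Proof. by apply: big1 => p _; rewrite !mxE mulr0 mulr0. Qed.

Lemma bform_subsq M u v :
  bform M u u - bform M v v = bform M u (u - v) + bform M (u - v) v.
Proof.
have -> : bform M u u = bform M u (u - v) + bform M u v.
  by rewrite -bformDr subrK.
have -> : bform M u v = bform M (u - v) v + bform M v v.
  by rewrite -bformDl subrK.
by rewrite addrA addrK.
Qed.

Lemma ler_bform M u v t : (forall i j, `|u 0 i| * `|v 0 j| <= t) ->
  `|bform M u v| <= l1norm M * t.
Proof.
move=> uvt; rewrite mulr_suml; apply: le_trans (ler_norm_sum _ _ _) _.
by apply: ler_sum => p _; rewrite !normrM ler_wpM2l.
Qed.

Lemma ler_norm_bform M u v : `|bform M u v| <= l1norm M * (`|u| * `|v|).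
Proof. by apply: ler_bform => i j; rewrite ler_pM ?ler_mx_norm_coord. Qed.

Lemma bform_dominant M u v i0 j0 t : 0 <= t ->
  (forall i j, M i j != 0 -> (i, j) != (i0, j0) -> `|u 0 i| * `|v 0 j| <= t) ->
  `|bform M u v - M i0 j0 * (u 0 i0 * v 0 j0)| <= l1norm M * t.
Proof.
move=> t0 uvt; rewrite /bform (bigD1 (i0, j0)) //= addrAC subrr add0r.
apply: le_trans (ler_norm_sum _ _ _) _.
rewrite /l1norm [X in X * _](bigD1 (i0, j0)) //= mulrDl mulr_suml.
apply: le_trans (ler_wpDl (mulr_ge0 (normr_ge0 _) t0) (lexx _)).
apply: ler_sum => -[i j] /= ij; rewrite !normrM.
have [->|M0] := eqVneq (M i j) 0; first by rewrite normr0 !mul0r.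
by rewrite ler_wpM2l // uvt.
Qed.

Lemma polar_dominant M u v i0 j0 t : 0 <= t ->
  (forall i j, M i j != 0 -> (i, j) != (i0, j0) ->
     `|u 0 i| * `|v 0 j| <= t /\ `|v 0 i| * `|u 0 j| <= t) ->
  `|polar M u v - M i0 j0 * (u 0 i0 * v 0 j0 + v 0 i0 * u 0 j0)|
    <= l1norm M * (2 * t).
Proof.
move=> t0 uvt; rewrite mulrDr /polar opprD addrACA mulrDl mul1r mulrDr.
apply: le_trans (ler_normD _ _) (lerD _ _);
  by apply: bform_dominant => // i j M0 ij; case: (uvt i j M0 ij).
Qed.

Lemma ler_norm_polar M u v : `|polar M u v| <= l1norm M * (2 * (`|u| * `|v|)).
Proof.
rewrite mulrDl mul1r mulrDr; apply: le_trans (ler_normD _ _) (lerD _ _).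
  exact: ler_norm_bform.
by rewrite [_ * `|v|]mulrC ler_norm_bform.
Qed.

Lemma bform_sq_lipschitz M u v r : `|u| <= r -> `|v| <= r ->
  `|bform M u u - bform M v v| <= l1norm M * (2 * r * `|u - v|).
Proof.
move=> ur vr; rewrite bform_subsq -mulrA mulrDl mul1r mulrDr.
apply: le_trans (ler_normD _ _) (lerD _ _).
  apply: le_trans (ler_norm_bform _ _ _) _.
  by rewrite ler_wpM2l ?l1norm_ge0 // ler_wpM2r.
apply: le_trans (ler_norm_bform _ _ _) _.
by rewrite ler_wpM2l ?l1norm_ge0 // mulrC ler_wpM2r.
Qed.

End BilinearForms.

Section QuadraticMaps.
Variables (R : realType) (n : nat) (d : 'rV[R]_n) (q : 'I_n -> 'M[R]_n).
Implicit Types a v : 'rV[R]_n.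

Definition quad_map a : 'rV[R]_n := \row_k (d 0 k * a 0 k + bform (q k) a a).

Definition coupling_jac a : 'M[R]_n :=
  \matrix_(j, k) \sum_i (q k i j + q k j i) * a 0 i.

Lemma mulmx_coupling_jac a v k : (v *m coupling_jac a) 0 k = polar (q k) a v.
Proof.
rewrite mxE /polar /bform -big_split /=.
rewrite -(pair_bigA _ (fun i j => q k i j * (a 0 i * v 0 j)
                                  + q k i j * (v 0 i * a 0 j))) /=.
under [RHS]eq_bigr do rewrite big_split.
rewrite big_split /= exchange_big -big_split; apply: eq_bigr => j _.
rewrite mxE mulr_sumr -big_split; apply: eq_bigr => i _ /=; ring.
Qed.

Lemma coupling_jac_colsum a k :
  \sum_j `|coupling_jac a j k| <= 2 * l1norm (q k) * `|a|.
Proof.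
have -> : 2 * l1norm (q k) * `|a|
    = \sum_j \sum_i (`|q k i j| + `|q k j i|) * `|a|.
  under [RHS]eq_bigr do rewrite -mulr_suml big_split.
  rewrite -mulr_suml big_split /= exchange_big /= !pair_bigA mulr2n mulrDl.
  by rewrite !mul1r.
apply: ler_sum => j _; rewrite mxE; apply: le_trans (ler_norm_sum _ _ _) _.
apply: ler_sum => i _; rewrite normrM ler_pM ?ler_normD //.
exact: ler_mx_norm_coord.
Qed.

Lemma mulmx_quad_jac a v k :
  (v *m (diag_mx d + coupling_jac a)) 0 k = d 0 k * v 0 k + polar (q k) a v.
Proof.
by rewrite mulmxDr mul_mx_diag mxE mulmx_coupling_jac mxE mulrC.
Qed.

Lemma quad_mapD a v :
  quad_map (a + v) = quad_map a + v *m (diag_mx d + coupling_jac a)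
                     + \row_k bform (q k) v v.
Proof.
apply/rowP => k; rewrite 2![in RHS]mxE mulmx_quad_jac !mxE /polar.
by rewrite bformDl !bformDr; ring.
Qed.

Lemma jacobian_quad_map a : 'J quad_map a = diag_mx d + coupling_jac a.
Proof.
set J := diag_mx d + _.
suff dQ : 'd quad_map a = mulmxr J :> ('rV[R]_n -> 'rV[R]_n).
  by apply/row_matrixP => i; rewrite !rowE /jacobian mul_rV_lin1 dQ.
apply: diff_unique; first exact: mulmxr_continuous.
apply/eqaddoP => eps eps0.
pose B := 1 + \sum_k l1norm (q k).
have B0 : 0 < B by rewrite ltr_pwDl // sumr_ge0 // => k _; exact: l1norm_ge0.
have qB k : l1norm (q k) <= B.
  rewrite /B (bigD1 k) //= addrCA lerDl addr_ge0 // sumr_ge0 // => l _.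
  exact: l1norm_ge0.
apply/nbhs_ballP; exists (eps / B); first exact: divr_gt0.
move=> v; rewrite -ball_normE /= sub0r normrN => /ltW vB.
rewrite !fctE /= /shift /cst [v + a]addrC quad_mapD -/J.
rewrite [X in X - _]addrC addrK.
apply: mx_norm_le => [|i k]; first by rewrite mulr_ge0 // ltW.
rewrite mxE; apply: le_trans (ler_norm_bform _ _ _) _.
apply: le_trans (ler_wpM2r _ (qB k)) _; first exact: mulr_ge0.
by rewrite mulrA ler_wpM2r // mulrC -ler_pdivlMr.
Qed.

End QuadraticMaps.

(** * Perturbation of a dominant diagonal entry *)

Section DominantEigenpair.
Variables (R : realType) (n : nat) (d : 'rV[R]_n.+1) (E : 'M[R]_n.+1).
Variables (delta gap : R).
Hypothesis E_colsum : forall k, \sum_j `|E j k| <= delta.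
Hypothesis delta_gap : 3 * delta < gap.
Hypothesis d_gap : forall k, k != ord0 -> gap <= `|d 0 ord0 - d 0 k|.
Implicit Types u v : 'rV[R]_n.+1.

Let delta_ge0 : 0 <= delta.
Proof. by apply: le_trans (E_colsum ord0); exact: sumr_ge0. Qed.

Let mulmx_le v k : `|(v *m E) 0 k| <= delta * `|v|.
Proof. exact: ler_mulmx_coord. Qed.

(* With [v_0 = 1], the zeroth component of [v (D + E) = lam v] is
   [lam = d_0 + (v E)_0], and the k-th one is
   [(d_0 - d_k) v_k = offdiag_residual v k]. *)
Definition offdiag_residual v k : R := (v *m E) 0 k - (v *m E) 0 ord0 * v 0 k.

Definition eigenvector_map v : 'rV[R]_n.+1 :=
  \row_k if k == ord0 then 1 else offdiag_residual v k / (d 0 ord0 - d 0 k).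

Lemma offdiag_residual_lipschitz u v k : `|u| <= 1 -> `|v| <= 1 ->
  `|offdiag_residual u k - offdiag_residual v k| <= 3 * delta * `|u - v|.
Proof.
move=> u1 v1; rewrite /offdiag_residual.
have -> : (u *m E) 0 k - (u *m E) 0 ord0 * u 0 k
    - ((v *m E) 0 k - (v *m E) 0 ord0 * v 0 k)
  = ((u - v) *m E) 0 k
    - (((u - v) *m E) 0 ord0 * u 0 k + (v *m E) 0 ord0 * (u - v) 0 k).
  by rewrite mulmxBl !mx_subE; ring.
have -> : 3 * delta * `|u - v|
    = delta * `|u - v| + (delta * `|u - v| * 1 + delta * 1 * `|u - v|) by ring.
apply: le_trans (ler_normB _ _) (lerD (mulmx_le _ _) _).
apply: le_trans (ler_normD _ _) _; rewrite !normrM lerD // ler_pM //.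
- exact: le_trans (ler_mx_norm_coord _ _ _) u1.
- exact: le_trans (mulmx_le _ _) (ler_wpM2l delta_ge0 v1).
- exact: ler_mx_norm_coord.
Qed.

Lemma diag_diff_neq0 k : k != ord0 -> d 0 ord0 - d 0 k != 0.
Proof.
move=> k0; rewrite -normr_gt0; apply: lt_le_trans (d_gap k0).
by have := delta_ge0; have := delta_gap; lra.
Qed.

Let ratio_itv : 0 <= 3 * delta / gap < 1.
Proof.
have [delta0 ltg] := (delta_ge0, delta_gap).
by rewrite ltr_pdivrMr ?mul1r ?ltg ?divr_ge0 //; lra.
Qed.

Lemma eigenvector_map_lipschitz u v : `|u| <= 1 -> `|v| <= 1 ->
  `|eigenvector_map u - eigenvector_map v| <= 3 * delta / gap * `|u - v|.
Proof.
move=> u1 v1; have [/andP[ratio0 _] delta0] := (ratio_itv, delta_ge0).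
apply: mx_norm_le => [|i k]; first exact: mulr_ge0.
rewrite !mxE; case: eqVneq => [_|k0]; first by rewrite subrr normr0 mulr_ge0.
rewrite -mulrBl normrM normfV mulrAC.
rewrite ler_pM ?invr_ge0 ?offdiag_residual_lipschitz //.
have gap0 : 0 < gap by have := delta_gap; lra.
by rewrite lef_pV2 ?d_gap // posrE ?normr_gt0 ?diag_diff_neq0.
Qed.

Lemma eigenvector_map_ball v : `|v| <= 1 -> `|eigenvector_map v| <= 1.
Proof.
move=> v1; have /andP[ratio0 ratio1] := ratio_itv.
apply: mx_norm_le => // i k; rewrite mxE; case: eqVneq => [_|k0].
  by rewrite normr1.
have := ler_mx_norm_coord (eigenvector_map v - eigenvector_map 0) 0 k.
rewrite !mxE (negPf k0) [offdiag_residual 0 k]/offdiag_residual mul0mx !mxE.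
rewrite !mul0r subrr mul0r subr0 => /le_trans; apply.
apply: le_trans (eigenvector_map_lipschitz v1 _) _; rewrite ?normr0 //.
by rewrite subr0 mulr_ile1 // ltW.
Qed.

Lemma dominant_eigenpair_exists : exists (lam : R) (v : 'rV[R]_n.+1),
  [/\ v *m (diag_mx d + E) = lam *: v, v 0 ord0 = 1, `|v| <= 1
    & `|lam - d 0 ord0| <= delta].
Proof.
have [v v1 vE] := @closed_ball_fixpoint R _ eigenvector_map 1 _ ler01 ratio_itv
  eigenvector_map_ball eigenvector_map_lipschitz.
have v01 : v 0 ord0 = 1 by rewrite vE mxE.
exists (d 0 ord0 + (v *m E) 0 ord0), v; split=> //; last first.
  by rewrite addrAC subrr add0r (le_trans (mulmx_le _ _)) // ler_piMr.
apply/rowP => k; rewrite mulmxDr mul_mx_diag [LHS]mxE [X in X + _]mxE [RHS]mxE.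
have [->|k0] := eqVneq k ord0; first by rewrite v01; ring.
have : v 0 k * (d 0 ord0 - d 0 k) = offdiag_residual v k.
  by rewrite [in LHS]vE mxE (negPf k0) divfK ?diag_diff_neq0.
by rewrite /offdiag_residual; lra.
Qed.

End DominantEigenpair.

(* The difference [w] between an eigenvector for [z] and the multiple of [u]
   with the same zeroth component satisfies [|w| <= 2 delta / gap * |w|]. *)
Lemma dominant_eigenvalue_unique (F : numFieldType) n (d : 'rV[F]_n.+1)
    (E : 'M[F]_n.+1) (delta gap lam z : F) (u : 'rV[F]_n.+1) :
  (forall k, \sum_j `|E j k| <= delta) -> 2 * delta < gap ->
  u *m (diag_mx d + E) = lam *: u -> u 0 ord0 = 1 -> `|u| <= 1 ->
  (forall k, k != ord0 -> gap <= `|z - d 0 k|) ->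
  eigenvalue (diag_mx d + E) z -> z = lam.
Proof.
move=> E_colsum delta_gap uM u0 u1 z_gap /eigenvalueP[v vM v_neq0].
have delta0 : 0 <= delta by apply: le_trans (E_colsum ord0); exact: sumr_ge0.
have gap0 : 0 < gap by apply: le_lt_trans delta_gap; rewrite mulr_ge0.
pose mu := v 0 ord0; pose w := v - mu *: u.
have w0 : w 0 ord0 = 0 by rewrite !mxE u0 mulr1 subrr.
have wM k : (z - d 0 k) * w 0 k = (w *m E) 0 k - (z - lam) * mu * u 0 k.
  have : (w *m (diag_mx d + E)) 0 k = z * w 0 k + (z - lam) * mu * u 0 k.
    by rewrite mulmxBl -scalemxAl uM vM !mxE; ring.
  rewrite mulmxDr mul_mx_diag [LHS]mxE [X in X + _]mxE => /(canRL (addKr _)) ->.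
  by ring.
have wE k : `|(w *m E) 0 k| <= delta * `|w| := ler_mulmx_coord w 0 (E_colsum k).
have z_lam : `|(z - lam) * mu| <= delta * `|w|.
  have /esym/eqP := wM ord0; rewrite w0 mulr0 u0 mulr1 subr_eq0 => /eqP <-.
  exact: wE.
have w_le k : gap * `|w 0 k| <= 2 * delta * `|w|.
  have [->|k0] := eqVneq k ord0; first by rewrite w0 normr0 mulr0 !mulr_ge0.
  apply: le_trans (ler_wpM2r (normr_ge0 _) (z_gap k k0)) _.
  rewrite -normrM wM -(mulrA 2) mulr_natl mulr2n.
  apply: le_trans (ler_normB _ _) (lerD (wE k) _).
  rewrite normrM; apply: le_trans z_lam; rewrite ler_piMr //.
  exact: le_trans (ler_mx_norm_coord _ _ _) u1.
have w_eq0 : w = 0.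
  apply/eqP; rewrite -normr_le0 -(@pmulr_rle0 _ (gap - 2 * delta)) ?subr_gt0 //.
  rewrite mulrBl subr_le0 mulrC -ler_pdivlMr //; apply: mx_norm_le => [|i k].
    by rewrite !(mulr_ge0, invr_ge0) // ltW.
  by rewrite ler_pdivlMr // mulrC (ord1 i).
have vE : v = mu *: u by apply/eqP; rewrite -subr_eq0 -/w w_eq0.
have mu0 : mu != 0 by apply: contra_neq v_neq0 => mu0; rewrite vE mu0 scale0r.
apply/eqP; rewrite -subr_eq0 -(mulIr_eq0 _ (mulIf mu0)) -normr_le0.
by rewrite (le_trans z_lam) // w_eq0 normr0 mulr0.
Qed.

Lemma normr_real_complex (R : rcfType) (x : R) :
  `|real_complex R x| = real_complex R `|x|.
Proof. by rewrite normc_def /= expr0n addr0 sqrtr_sqr. Qed.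

(** * The pitchfork bifurcation *)

Lemma lipschitz_within_continuous (R : realType) (f : R -> R) (a b L : R) :
  (forall x y, a <= x <= b -> a <= y <= b -> `|f x - f y| <= L * `|x - y|) ->
  {within `[a, b], continuous f}.
Proof.
move=> f_lip; apply/subspace_continuousP => x; rewrite /= in_itv /= => xab.
apply/cvgrPdist_le => /= e e0; rewrite near_withinE.
near=> y; rewrite /= in_itv /= => yab; apply: le_trans (f_lip _ _ xab yab) _.
have L1 : 0 < `|L| + 1 by rewrite ltr_wpDl.
apply: (@le_trans _ _ ((`|L| + 1) * `|x - y|)).
  by rewrite ler_wpM2r // (le_trans (ler_norm L)) // lerDl.
rewrite mulrC -ler_pdivlMr //; near: y.
by apply: cvgr_dist_le => //; rewrite divr_gt0.
Unshelve. all: by end_near. Qed.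

Section PerturbedCubic.
Variables (R : realType) (h : R -> R) (e mu T : R).
Hypotheses (e_gt0 : 0 < e) (mu_gt0 : 0 < mu) (T_small : 4 * T * e <= mu ^+ 2).
Local Notation w := (e / mu).
Hypothesis h_near_cubic : forall x, 0 <= x <= Num.sqrt (2 * w) ->
  `|h x - x * (e - mu * x ^+ 2)| <= T * x ^+ 5.

Lemma perturbed_cubic_dist t : 0 < t <= 2 ->
  `|h (Num.sqrt (t * w)) - Num.sqrt (t * w) * (e * (1 - t))|
    <= Num.sqrt (t * w) * (t ^+ 2 * (e / 4)).
Proof.
move=> /andP[t0 t2]; have w0 : 0 < w by rewrite divr_gt0.
have Tw : 4 * T * w ^+ 2 <= e.
  have -> : 4 * T * w ^+ 2 = 4 * T * e * (e / mu ^+ 2).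
    by field; rewrite gt_eqF.
  rewrite mulrCA ler_piMr ?(ltW e_gt0) //.
  by rewrite ler_pdivrMr ?mul1r ?exprn_gt0.
set x := Num.sqrt (t * w); have x0 : 0 <= x := sqrtr_ge0 _.
have xE : x ^+ 2 = t * w by rewrite sqr_sqrtr // mulr_ge0 // ltW.
have -> : e * (1 - t) = e - mu * x ^+ 2.
  by rewrite xE; field; rewrite gt_eqF.
apply: le_trans (h_near_cubic _) _.
  by rewrite x0 ler_wsqrtr // ler_wpM2r // ltW.
have -> : T * x ^+ 5 = x * (T * (x ^+ 2) ^+ 2) by ring.
by rewrite ler_wpM2l // xE exprMn mulrCA ler_wpM2l ?sqr_ge0 //; lra.
Qed.

(* The square [t * (e / mu)] is tested at [t = 1/2] and at [t = 2], on both
   sides of the root [x^2 = e / mu] of the unperturbed cubic. *)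
Lemma perturbed_cubic_root :
  {within `[0, Num.sqrt (2 * w)], continuous h} ->
  exists2 x, 0 < x <= Num.sqrt (2 * w) & h x = 0.
Proof.
move=> h_cont; have w0 : 0 < w by rewrite divr_gt0.
have sqrt_gt0 t : 0 < t -> 0 < Num.sqrt (t * w).
  by move=> t0; rewrite sqrtr_gt0 mulr_gt0.
set x1 := Num.sqrt (2^-1 * w); set x2 := Num.sqrt (2 * w).
have [x1_gt0 x2_gt0] : 0 < x1 /\ 0 < x2 by split; apply: sqrt_gt0.
have x12 : x1 <= x2 by rewrite ler_wsqrtr // ler_wpM2r ?ltW //; lra.
have hx1 : 0 <= h x1.
  have := @perturbed_cubic_dist 2^-1.
  rewrite -/x1 ler_norml => /(_ _)/andP[|h1 _]; first lra.
  by have := mulr_gt0 x1_gt0 e_gt0; lra.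
have hx2 : h x2 <= 0.
  have := @perturbed_cubic_dist 2.
  rewrite -/x2 ler_norml => /(_ _)/andP[|_ h2]; first lra.
  by have := mulr_gt0 x2_gt0 e_gt0; lra.
have h12 : {within `[x1, x2], continuous h}.
  apply: continuous_subspaceW h_cont => x; rewrite /= !in_itv /=.
  by move=> /andP[x1x ->]; rewrite andbT (le_trans (ltW x1_gt0)).
have [|x] := IVT (v := 0) x12 h12; first by rewrite ge_min le_max hx1 hx2 orbT.
rewrite in_itv /= => /andP[x1x xx2] hx0; exists x => //.
by rewrite xx2 andbT (lt_le_trans x1_gt0).
Qed.

End PerturbedCubic.

Section SmallParameters.
Variables (R : realFieldType) (b : R).
Hypothesis b_ge0 : 0 <= b.

(* [28 ^ 2 = 4 * 196]: the remainder [196 (b x)^4] of the leading eigenvalue is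
   evaluated at [x^2 <= 2 e / mu]. *)
Definition pitchfork_const (mu : R) : R := (28 * b ^+ 2 / mu) ^+ 2.

Lemma pitchfork_const_antitone m mu :
  0 < m <= mu -> pitchfork_const mu <= pitchfork_const m.
Proof.
move=> /andP[m0 m_mu]; have mu0 := lt_le_trans m0 m_mu.
have num_ge0 : 0 <= 28 * b ^+ 2 by rewrite mulr_ge0 ?sqr_ge0.
rewrite ler_pXn2r ?nnegrE ?divr_ge0 ?(ltW m0) ?(ltW mu0) //.
by rewrite ler_wpM2l // lef_pV2.
Qed.

Variables (e mu : R).
Hypotheses (e_gt0 : 0 < e) (mu_gt0 : 0 < mu) (mu_le : mu <= b ^+ 2).
Hypothesis const_e_lt1 : pitchfork_const mu * e < 1.

Lemma pitchfork_const_mul_lt1 : (28 * b ^+ 2) ^+ 2 * e < mu ^+ 2.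
Proof.
have := const_e_lt1; rewrite /pitchfork_const expr_div_n mulrAC.
by rewrite ltr_pdivrMr ?exprn_gt0 // mul1r.
Qed.

Lemma amplitude_small x : 0 <= x -> x ^+ 2 <= 2 * (e / mu) -> 8 * b * x < 1.
Proof.
move=> x0 x2; have b8x : 0 <= 8 * b * x by rewrite !mulr_ge0.
rewrite -(@ltr_pXn2r _ 2) ?nnegrE // expr1n.
have -> : (8 * b * x) ^+ 2 = 64 * b ^+ 2 * x ^+ 2 by ring.
apply: (@le_lt_trans _ _ (64 * b ^+ 2 * (2 * (e / mu)))).
  by rewrite ler_wpM2l // mulr_ge0 ?exprn_ge0.
have -> : 64 * b ^+ 2 * (2 * (e / mu)) = 128 * b ^+ 2 * e / mu by ring.
rewrite ltr_pdivrMr // mul1r -(ltr_pM2r mu_gt0) -expr2.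
apply: le_lt_trans pitchfork_const_mul_lt1.
have -> : (28 * b ^+ 2) ^+ 2 * e = 784 * (b ^+ 2 * e * b ^+ 2) by ring.
have -> : 128 * b ^+ 2 * e * mu = 128 * (b ^+ 2 * e * mu) by ring.
have b2e : 0 <= b ^+ 2 * e by rewrite mulr_ge0 ?exprn_ge0 ?(ltW e_gt0).
by have := ler_wpM2l b2e mu_le; have := mulr_ge0 b2e (ltW mu_gt0); lra.
Qed.

Lemma distance_small : 4 * e < 1.
Proof.
have mu2 : 0 < mu ^+ 2 by rewrite exprn_gt0.
rewrite -(ltr_pM2r mu2) mul1r; apply: le_lt_trans pitchfork_const_mul_lt1.
rewrite mulrAC ler_wpM2r ?(ltW e_gt0) //.
have -> : 4 * mu ^+ 2 = (2 * mu) ^+ 2 by ring.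
rewrite ler_pXn2r ?nnegrE ?mulr_ge0 ?sqr_ge0 ?(ltW mu_gt0) //.
by have := mu_le; have := sqr_ge0 b; lra.
Qed.

End SmallParameters.

(* The equation says [lam - 1 = (e - M + rem) - 2 M / lam]; hence
   [lam - 1 = O(y)], and replacing [M / lam] by [M] costs [(lam - 1)^2]. *)
Lemma eigenvalue_expansion (R : realFieldType) (lam e M rem X y : R) :
  2^-1 <= lam <= 3 / 2 -> 0 <= M <= y -> X <= y ->
  `|e - M| <= X -> `|rem| <= X ->
  lam * (lam - 1) = lam * (e - M + rem) - 2 * M ->
  `|lam - (1 - 2 * e)| <= 5 * X + 36 * y ^+ 2.
Proof.
move=> /andP[lam_ge lam_le] /andP[M0 My] Xy; rewrite !ler_norml.
move=> /andP[eM1 eM2] /andP[rem1 rem2] lamE.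
pose t := e - M + rem; pose w := lam - 1 - t.
have wE : lam * w = - (2 * M) by rewrite mulrBr lamE /t; ring.
have w_le0 : w <= 0 by rewrite -(@pmulr_rle0 _ lam) ?wE; lra.
have w_ge : - (4 * M) <= w by clear - wE w_le0 lam_ge M0; nra.
have lam1_le : `|lam - 1| <= 6 * y.
  by rewrite ler_norml /w /t in w_le0 w_ge *; lra.
have lam1_sqr : (lam - 1) ^+ 2 <= 36 * y ^+ 2.
  rewrite -real_normK ?num_real //.
  have -> : 36 * y ^+ 2 = (6 * y) ^+ 2 by ring.
  by rewrite ler_pXn2r ?nnegrE //; lra.
have lam_t : `|lam * t| <= 3 / 2 * (2 * X).
  by rewrite normrM ler_pM // ler_norml /t; lra.
have -> : lam - (1 - 2 * e) = 2 * (e - M) + lam * t - (lam - 1) ^+ 2.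
  by have -> : lam * t = lam * (lam - 1) + 2 * M; [rewrite lamE subrK | ring].
by have := sqr_ge0 (lam - 1); move: lam_t; rewrite ler_norml; lra.
Qed.

Section Pitchfork.
Variables (R : realType) (n : nat).
Local Notation N := n.+2.

Definition ord_snd : 'I_N := lift ord0 ord0.

(* Fixed points of [quad_map d q] near [0]: the zeroth mode is critical and
   [e] is the distance to the bifurcation point; all other modes are damped. *)
Record pitchfork (rho B e : R) (d : 'rV[R]_N) (q : 'I_N -> 'M[R]_N) : Prop :=
    Pitchfork {
  damping_itv : 0 <= rho < 1;
  critical_rate : d 0 ord0 = 1 + e;
  second_rate : d 0 ord_snd = 0;
  damped_rate : forall k, k != ord0 -> `|d 0 k| <= rho;
  coupling_le : forall k, l1norm (q k) <= B;
  critical_coupling : forall i j, q ord0 i j != 0 ->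
    (i, j) = (ord_snd, ord0) \/ (1 < i)%N /\ j != ord0;
  second_coupling : forall i j, q ord_snd i j != 0 -> (i, j) = (ord0, ord0);
  higher_coupling : forall k : 'I_N, (1 < k)%N -> q k ord0 ord0 = 0 }.

Definition slaving_const (rho B : R) : R := B / (1 - rho).

(* The coefficient of the cubic term in [e x - saturation q * x^3 + O(x^5)],
   the critical equation after elimination of the damped modes. *)
Definition saturation (q : 'I_N -> 'M[R]_N) : R :=
  - q ord0 ord_snd ord0 * q ord_snd ord0 ord0.

Definition slaved (d : 'rV[R]_N) q (a : 'rV[R]_N) (x : R) : Prop :=
  a 0 ord0 = x /\ forall k, k != ord0 -> a 0 k = quad_map d q a 0 k.

Lemma ord_gt1_neq0 (k : 'I_N) : (1 < k)%N -> k != ord0.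
Proof. by case: k => -[|[|k]]. Qed.

Variables (rho B e : R) (d : 'rV[R]_N) (q : 'I_N -> 'M[R]_N).
Hypothesis pf : pitchfork rho B e d q.
Local Notation beta := (slaving_const rho B).
Local Notation mu := (saturation q).

Lemma damping_gap_gt0 : 0 < 1 - rho.
Proof. by have /andP[_] := damping_itv pf; rewrite subr_gt0. Qed.

Lemma coupling_bound_ge0 : 0 <= B.
Proof. exact: le_trans (l1norm_ge0 _) (coupling_le pf ord0). Qed.

Lemma slaving_constE : B = beta * (1 - rho).
Proof. by rewrite divfK // gt_eqF ?damping_gap_gt0. Qed.

Lemma slaving_const_ge0 : 0 <= beta.
Proof. by rewrite divr_ge0 ?coupling_bound_ge0 // ltW ?damping_gap_gt0. Qed.

Lemma coupling_bound_le : B <= beta.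
Proof.
rewrite [leLHS]slaving_constE ler_piMr ?slaving_const_ge0 // lerBlDr lerDl.
by have /andP[] := damping_itv pf.
Qed.

Lemma saturation_le : mu <= beta ^+ 2.
Proof.
apply: le_trans (ler_norm _) _; rewrite normrM normrN expr2.
have qle k i j : `|q k i j| <= beta.
  apply: le_trans (ler_l1norm _ _ _) _.
  exact: le_trans (coupling_le pf k) coupling_bound_le.
by rewrite ler_pM.
Qed.

Lemma damped_le k (y z t : R) : k != ord0 -> 0 <= t -> (1 - d 0 k) * y = z ->
  `|z| <= l1norm (q k) * t -> `|y| <= beta * t.
Proof.
move=> k0 t0 <- yt; have := damped_rate pf k0; have gap0 := damping_gap_gt0.
rewrite ler_norml => /andP[_ dk].
rewrite -(ler_pM2l gap0) mulrA [_ * beta]mulrC -slaving_constE.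
apply: (le_trans _ (ler_wpM2r t0 (coupling_le pf k))); apply: le_trans yt.
rewrite normrM ler_wpM2r // ger0_norm ?lerD2l ?lerN2 //.
by rewrite subr_ge0; lra.
Qed.

Lemma damped_rate_neq1 k : k != ord0 -> 1 - d 0 k != 0.
Proof.
move=> k0; have := damped_rate pf k0; have := damping_gap_gt0.
by rewrite ler_norml; lra.
Qed.

Lemma slavedE a x k : slaved d q a x -> k != ord0 ->
  (1 - d 0 k) * a 0 k = bform (q k) a a.
Proof.
by case=> _ aE k0; rewrite mulrBl mul1r {1}aE // mxE addrC addKr.
Qed.

Lemma slaved_exists x : 0 <= x -> 4 * beta * x <= 1 ->
  exists2 a, `|a| <= x & slaved d q a x.
Proof.
move=> x0 bx; have beta0 := slaving_const_ge0.
pose f (u : 'rV[R]_N) : 'rV[R]_N :=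
  \row_k (if k == ord0 then x else bform (q k) u u / (1 - d 0 k)).
have fE u k : k != ord0 -> (1 - d 0 k) * f u 0 k = bform (q k) u u.
  by move=> k0; rewrite mxE (negPf k0) mulrC divfK ?damped_rate_neq1.
have half01 : 0 <= (2^-1 : R) < 1 by rewrite invr_ge0 ler0n invf_lt1 ?ltr1n.
have [u ur|u v ur vr|u ur uE] := @closed_ball_fixpoint R _ f x _ x0 half01.
- apply: mx_norm_le => // i k; rewrite (ord1 i).
  have [->|k0] := eqVneq k ord0; first by rewrite mxE ger0_norm.
  apply: (@le_trans _ _ (beta * (`|u| * `|u|))).
    by apply: damped_le (fE u k k0) (ler_norm_bform _ _ _); rewrite ?mulr_ge0.
  apply: (@le_trans _ _ (beta * (x * x))); first by rewrite ler_wpM2l ?ler_pM.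
  by rewrite mulrA ler_piMl //; lra.
- apply: mx_norm_le => [|i k]; first by rewrite mulr_ge0.
  rewrite (ord1 i); have [->|k0] := eqVneq k ord0.
    by rewrite !mxE eqxx subrr normr0 mulr_ge0.
  apply: (@le_trans _ _ (beta * (2 * x * `|u - v|))).
    apply: (damped_le k0 _ _ (bform_sq_lipschitz _ ur vr)).
      by rewrite !mulr_ge0.
    by rewrite -!fE // -mulrBr mx_subE.
  by rewrite mulrA ler_wpM2r //; lra.
- exists u => //; split=> [|k k0]; first by rewrite uE mxE.
  by rewrite mxE -(fE u k k0) -uE; ring.
Qed.

Lemma slaved_lipschitz a b x y r :
  `|a| <= r -> `|b| <= r -> 4 * beta * r <= 1 ->
  slaved d q a x -> slaved d q b y -> `|a - b| <= `|x - y|.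
Proof.
move=> ar br small sa sb; have beta0 := slaving_const_ge0.
have r0 : 0 <= r := le_trans (normr_ge0 a) ar.
have : `|a - b| <= Num.max `|x - y| (2^-1 * `|a - b|).
  apply: mx_norm_le => [|i k]; first by rewrite le_max normr_ge0.
  rewrite (ord1 i) le_max; have [->|k0] := eqVneq k ord0.
    by rewrite !mxE sa.1 sb.1 lexx.
  apply/orP; right; apply: (@le_trans _ _ (beta * (2 * r * `|a - b|))).
    apply: (damped_le k0 _ _ (bform_sq_lipschitz _ ar br)).
      by rewrite !mulr_ge0.
    by rewrite -(slavedE sa k0) -(slavedE sb k0) -mulrBr mx_subE.
  by rewrite mulrA ler_wpM2r //; lra.
rewrite le_max => /orP[//|].
by have := normr_ge0 (a - b); have := normr_ge0 (x - y); lra.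
Qed.

Section SlavedAsymptotics.
Variables (a : 'rV[R]_N) (x : R).
Hypothesis a_le : `|a| <= x.
Hypothesis a_slaved : slaved d q a x.

Let x_ge0 : 0 <= x := le_trans (normr_ge0 a) a_le.

Let a_coord k : `|a 0 k| <= x.
Proof. exact: le_trans (ler_mx_norm_coord _ _ _) a_le. Qed.

Lemma slaved_order2 k : k != ord0 -> `|a 0 k| <= beta * x ^+ 2.
Proof.
move=> k0; apply: damped_le (slavedE a_slaved k0) _ => //.
  by rewrite exprn_ge0.
by apply: ler_bform => i j; rewrite expr2 ler_pM.
Qed.

Lemma slaved_order3 (k : 'I_N) : (1 < k)%N -> `|a 0 k| <= beta ^+ 2 * x ^+ 3.
Proof.
move=> k1; have k0 := ord_gt1_neq0 k1; have beta0 := slaving_const_ge0.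
have t0 : 0 <= beta * x ^+ 3 by rewrite mulr_ge0 ?exprn_ge0.
rewrite expr2 -mulrA; apply: damped_le (slavedE a_slaved k0) _ => //.
have := bform_dominant (M := q k) (u := a) (v := a) (i0 := ord0) (j0 := ord0)
  t0.
rewrite (higher_coupling pf) // mul0r subr0; apply=> i j _.
have [->|i0] := eqVneq i ord0.
  rewrite xpair_eqE eqxx /= => j0.
  rewrite (_ : beta * _ = x * (beta * x ^+ 2)); last by ring.
  by rewrite ler_pM ?slaved_order2.
move=> _; rewrite exprSr mulrA; apply: ler_pM => //; exact: slaved_order2.
Qed.

Lemma slaved_second : a 0 ord_snd = q ord_snd ord0 ord0 * x ^+ 2.
Proof.
have := slavedE a_slaved (isT : ord_snd != ord0).
rewrite (second_rate pf) subr0 mul1r => ->.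
have := bform_dominant (M := q ord_snd) (u := a) (v := a) (i0 := ord0)
  (j0 := ord0) (lexx (0 : R)).
rewrite mulr0 normr_le0 subr_eq0 a_slaved.1 -expr2 => second_le.
apply/eqP/second_le => i j.
by move=> /(second_coupling pf) ->; rewrite eqxx.
Qed.

Lemma slaved_critical :
  `|bform (q ord0) a a + mu * x ^+ 3| <= beta ^+ 4 * x ^+ 5.
Proof.
have beta0 := slaving_const_ge0.
have t0 : 0 <= beta ^+ 3 * x ^+ 5 by rewrite mulr_ge0 ?exprn_ge0.
rewrite (_ : bform _ _ _ + _ = bform (q ord0) a a
    - q ord0 ord_snd ord0 * (a 0 ord_snd * a 0 ord0)); last first.
  by rewrite slaved_second a_slaved.1 /saturation; ring.
rewrite exprS -mulrA.
have mass_le := le_trans (coupling_le pf ord0) coupling_bound_le.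
apply: (le_trans _ (ler_wpM2r t0 mass_le)).
apply: bform_dominant => // i j /(critical_coupling pf)[->|[i1 j0] _].
  by rewrite eqxx.
rewrite (_ : _ * x ^+ 5 = (beta ^+ 2 * x ^+ 3) * (beta * x ^+ 2)); last by ring.
by rewrite ler_pM ?slaved_order2 ?slaved_order3.
Qed.

End SlavedAsymptotics.

Section Branch.
Hypothesis e_gt0 : 0 < e.
Hypothesis mu_gt0 : 0 < mu.
Hypothesis const_e_lt1 : pitchfork_const beta mu * e < 1.

Lemma critical_equation_continuous (A : R -> 'rV[R]_N) r : 4 * beta * r <= 1 ->
  (forall x, 0 <= x <= r -> `|A x| <= x /\ slaved d q (A x) x) ->
  {within `[0, r], continuous (fun x => e * x + bform (q ord0) (A x) (A x))}.
Proof.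
move=> br AP.
apply: (@lipschitz_within_continuous _ _ _ _ (e + l1norm (q ord0) * (2 * r))).
move=> x y xr yr; have [[Ax sx] [Ay sy]] := (AP x xr, AP y yr).
case/andP: xr yr => x0 xr /andP[_ yr]; have r0 := le_trans x0 xr.
rewrite opprD addrACA -mulrBr mulrDl.
apply: le_trans (ler_normD _ _) (lerD _ _).
  by rewrite normrM ger0_norm // ltW.
apply: le_trans (bform_sq_lipschitz _ (le_trans Ax xr) (le_trans Ay yr)) _.
rewrite -[leRHS]mulrA ler_wpM2l ?l1norm_ge0 // ler_wpM2l ?mulr_ge0 //.
exact: slaved_lipschitz (le_trans Ax xr) (le_trans Ay yr) br sx sy.
Qed.

Lemma pitchfork_branch : exists (a : 'rV[R]_N) (x : R),
  [/\ quad_map d q a = a, a 0 ord0 = x, `|a| <= x, 0 < x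
    & x ^+ 2 <= 2 * (e / mu)].
Proof.
have w0 : 0 < e / mu by rewrite divr_gt0.
set r := Num.sqrt (2 * (e / mu)).
have r2 : r ^+ 2 = 2 * (e / mu) by rewrite sqr_sqrtr // mulr_ge0 // ltW.
have beta0 := slaving_const_ge0; have r0 : 0 <= r := sqrtr_ge0 _.
have br : 4 * beta * r <= 1.
  have := amplitude_small beta0 e_gt0 mu_gt0 saturation_le const_e_lt1 r0.
  by rewrite r2 => /(_ (lexx _)); have := mulr_ge0 beta0 r0; lra.
have slaved_ex x : exists a : 'rV[R]_N,
    0 <= x <= r -> `|a| <= x /\ slaved d q a x.
  have [xr|] := boolP (0 <= x <= r); last by exists 0.
  have /andP[x0 xr'] := xr.
  have [|a ax sa] := slaved_exists x0; last by exists a.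
  by apply: le_trans br; rewrite ler_wpM2l // mulr_ge0.
have [A AP] := choice slaved_ex.
have [|x xr|x /andP[x0 xr] hx] := perturbed_cubic_root
  (h := fun x => e * x + bform (q ord0) (A x) (A x)) (T := beta ^+ 4)
  e_gt0 mu_gt0 _ _ (critical_equation_continuous br AP).
- have := pitchfork_const_mul_lt1 mu_gt0 const_e_lt1.
  have -> : (28 * beta ^+ 2) ^+ 2 * e = 784 * (beta ^+ 4 * e) by ring.
  by have := mulr_ge0 (exprn_ge0 4 beta0) (ltW e_gt0); lra.
- have [Ax sx] := AP x xr; apply: le_trans (slaved_critical Ax sx).
  by rewrite le_eqVlt; apply/orP; left; apply/eqP; congr `|_|; ring.
have [|Ax sx] := AP x; first by rewrite ltW.
exists (A x), x; split=> //; last by rewrite -r2 ler_pXn2r ?nnegrE // ltW.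
  apply/rowP => k; have [->|k0] := eqVneq k ord0; last by rewrite -sx.2.
  by rewrite mxE sx.1 (critical_rate pf) mulrDl mul1r -addrA hx addr0.
exact: sx.1.
Qed.

End Branch.

Section BranchLinearization.
Variables (a : 'rV[R]_N) (x : R).
Hypothesis a_fix : quad_map d q a = a.
Hypothesis a_critical : a 0 ord0 = x.
Hypothesis a_le : `|a| <= x.
Hypothesis x_gt0 : 0 < x.
Hypothesis x_small : 8 * beta * x < 1.

Let a_slaved : slaved d q a x.
Proof. by split=> // k _; rewrite a_fix. Qed.

Let a_coord k : `|a 0 k| <= x.
Proof. exact: le_trans (ler_mx_norm_coord _ _ _) a_le. Qed.

Lemma branch_distance : `|e - mu * x ^+ 2| <= beta ^+ 4 * x ^+ 4.
Proof.
have critical : bform (q ord0) a a = - (e * x).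
  have /rowP/(_ ord0) := a_fix; rewrite mxE a_critical (critical_rate pf).
  by lra.
rewrite -(ler_pM2r x_gt0) -[X in _ * X <= _](gtr0_norm x_gt0) -normrM.
have -> : beta ^+ 4 * x ^+ 4 * x = beta ^+ 4 * x ^+ 5 by ring.
have -> : (e - mu * x ^+ 2) * x = - (bform (q ord0) a a + mu * x ^+ 3).
  by rewrite critical; ring.
by rewrite normrN slaved_critical.
Qed.

Lemma coupling_jac_branch_le k :
  \sum_j `|coupling_jac q a j k| <= 2 * B * x.
Proof.
apply: le_trans (coupling_jac_colsum q a k) _.
by rewrite ler_pM ?mulr_ge0 ?l1norm_ge0 // ler_pM2l // (coupling_le pf).
Qed.

Lemma branch_coupling_small : 8 * (B * x) < 1 - rho.
Proof.
have gap0 := damping_gap_gt0; have := x_small; rewrite -(ltr_pM2r gap0) mul1r.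
by apply: le_lt_trans; rewrite [X in X * x]slaving_constE; lra.
Qed.

Hypothesis e_ge0 : 0 <= e.

Lemma branch_eigenpair_exists : exists (lam : R) (v : 'rV[R]_N),
  [/\ v *m (diag_mx d + coupling_jac q a) = lam *: v, v 0 ord0 = 1, `|v| <= 1
    & `|lam - (1 + e)| <= 2 * B * x].
Proof.
rewrite -(critical_rate pf).
apply: (dominant_eigenpair_exists (gap := 1 - rho) coupling_jac_branch_le).
  have := branch_coupling_small.
  by have := mulr_ge0 coupling_bound_ge0 (ltW x_gt0); lra.
move=> k k0; have := damped_rate pf k0; rewrite (critical_rate pf) ler_norml.
by move=> /andP[_ dk]; apply: le_trans (ler_norm _); have := e_ge0; lra.
Qed.

Section LeadingEigenvector.
Variables (lam : R) (v : 'rV[R]_N).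
Hypothesis v_eigen : v *m (diag_mx d + coupling_jac q a) = lam *: v.
Hypothesis v_critical : v 0 ord0 = 1.
Hypothesis v_le : `|v| <= 1.
Hypothesis lam_near : `|lam - (1 + e)| <= 2 * B * x.

Let v_coord k : `|v 0 k| <= 1.
Proof. exact: le_trans (ler_mx_norm_coord _ _ _) v_le. Qed.

Let beta_x_ge0 : 0 <= beta * x.
Proof. by rewrite mulr_ge0 ?slaving_const_ge0 // ltW. Qed.

Lemma eigenvectorE k : lam * v 0 k = d 0 k * v 0 k + polar (q k) a v.
Proof. by rewrite -mulmx_quad_jac v_eigen mxE. Qed.

Lemma leading_eigenvalue_gt : (3 + rho) / 4 < lam.
Proof.
have [Bx e0] := (branch_coupling_small, e_ge0).
by move: lam_near; rewrite ler_norml => /andP[lam_ge _]; lra.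
Qed.

Lemma eigenvector_damped k t : k != ord0 -> 0 <= t ->
  `|polar (q k) a v| <= l1norm (q k) * t -> `|v 0 k| <= 2 * beta * t.
Proof.
move=> k0 t0 vt.
have [gap0 lam_gt] := (damping_gap_gt0, leading_eigenvalue_gt).
have := damped_rate pf k0; rewrite ler_norml => /andP[_ dk].
have polarE : polar (q k) a v = (lam - d 0 k) * v 0 k.
  by rewrite mulrBl eigenvectorE addrC addKr.
rewrite -(ler_pM2l gap0).
have -> : (1 - rho) * (2 * beta * t) = 2 * (B * t).
  by rewrite [X in 2 * (X * t)]slaving_constE; ring.
apply: (@le_trans _ _ (2 * `|polar (q k) a v|)); last first.
  by rewrite ler_pM2l // (le_trans vt) // ler_wpM2r ?(coupling_le pf).
rewrite polarE normrM mulrA ler_wpM2r // ger0_norm; lra.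
Qed.

Lemma eigenvector_order1 k : k != ord0 -> `|v 0 k| <= 4 * (beta * x).
Proof.
move=> k0; have -> : 4 * (beta * x) = 2 * beta * (2 * x) by ring.
apply: eigenvector_damped => //; first by rewrite mulr_ge0 // ltW.
apply: le_trans (ler_norm_polar _ _ _) _; rewrite ler_wpM2l ?l1norm_ge0 //.
by rewrite ler_wpM2l // -[leRHS]mulr1 ler_pM.
Qed.

Lemma eigenvector_order2 (k : 'I_N) :
  (1 < k)%N -> `|v 0 k| <= 16 * (beta * x) ^+ 2.
Proof.
move=> k1; have k0 := ord_gt1_neq0 k1.
pose t := 4 * (beta * x) * x.
have t0 : 0 <= t by rewrite mulr_ge0 ?(ltW x_gt0) // mulr_ge0.
have coords_le i j : (i, j) != (ord0, ord0) -> `|a 0 i| * `|v 0 j| <= t.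
  have [->|i0] := eqVneq i ord0.
    rewrite xpair_eqE eqxx /= => j0.
    by rewrite /t mulrC ler_pM // eigenvector_order1.
  move=> _; have := ler_pM (normr_ge0 _) (normr_ge0 _)
    (slaved_order2 a_le a_slaved i0) (v_coord j).
  have := mulr_ge0 beta_x_ge0 (ltW x_gt0); rewrite /t; lra.
have -> : 16 * (beta * x) ^+ 2 = 2 * beta * (2 * t) by rewrite /t; ring.
apply: eigenvector_damped => //; first by rewrite mulr_ge0.
have := polar_dominant (M := q k) (u := a) (v := v) (i0 := ord0) (j0 := ord0)
  t0.
rewrite (higher_coupling pf) // mul0r subr0; apply=> i j _ ij.
split; [|rewrite mulrC]; apply: coords_le => //.
by rewrite xpair_eqE andbC -xpair_eqE.
Qed.

Lemma eigenvector_second :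
  lam * v 0 ord_snd = 2 * (q ord_snd ord0 ord0 * x).
Proof.
rewrite eigenvectorE (second_rate pf) mul0r add0r.
have := polar_dominant (M := q ord_snd) (u := a) (v := v) (i0 := ord0)
  (j0 := ord0) (lexx (0 : R)).
rewrite !mulr0 normr_le0 subr_eq0 v_critical a_critical => second_le.
rewrite (eqP (second_le _)); first by ring.
by move=> i j /(second_coupling pf) ->; rewrite eqxx.
Qed.

Lemma eigenvector_critical :
  `|polar (q ord0) a v - q ord0 ord_snd ord0 * (a 0 ord_snd + v 0 ord_snd * x)|
    <= 32 * (beta * x) ^+ 4.
Proof.
pose t := 16 * (beta ^+ 3 * x ^+ 4).
have beta0 := slaving_const_ge0.
have t0 : 0 <= t.
  by rewrite mulr_ge0 // mulr_ge0 // exprn_ge0 // ltW.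
have -> : 32 * (beta * x) ^+ 4 = beta * (2 * t) by rewrite /t; ring.
have := polar_dominant (M := q ord0) (u := a) (v := v) (i0 := ord_snd)
  (j0 := ord0) t0.
rewrite v_critical a_critical mulr1 => critical_le.
apply: (@le_trans _ _ (l1norm (q ord0) * (2 * t))); last first.
  rewrite ler_wpM2r //; first by rewrite mulr_ge0.
  exact: le_trans (coupling_le pf _) coupling_bound_le.
apply: critical_le => i j /(critical_coupling pf)[->|[i1 j0] _].
  by rewrite eqxx.
have := ler_pM (normr_ge0 _) (normr_ge0 _)
  (slaved_order3 a_le a_slaved i1) (eigenvector_order1 j0).
have := ler_pM (normr_ge0 _) (normr_ge0 _)
  (eigenvector_order2 i1) (slaved_order2 a_le a_slaved j0).
rewrite (_ : 16 * _ * _ = t); last by rewrite /t; ring.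
rewrite (_ : _ * _ * (4 * _) = 4^-1 * t); last by rewrite /t; field.
by split=> //; lra.
Qed.

Lemma leading_eigenvalue_equation :
  lam * (lam - 1) = lam * (e - mu * x ^+ 2 + (polar (q ord0) a v
    - q ord0 ord_snd ord0 * (a 0 ord_snd + v 0 ord_snd * x)))
    - 2 * (mu * x ^+ 2).
Proof.
have lam1 : lam - 1 = e + polar (q ord0) a v.
  have := eigenvectorE ord0; rewrite v_critical (critical_rate pf) !mulr1.
  by move=> ->; ring.
have muE : mu * x ^+ 2 = - (q ord0 ord_snd ord0 * a 0 ord_snd).
  by rewrite (slaved_second a_slaved) /saturation; ring.
have feedback : q ord0 ord_snd ord0 * x * (lam * v 0 ord_snd)
    = - (2 * (mu * x ^+ 2)) by rewrite eigenvector_second /saturation; ring.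
rewrite lam1; move: feedback muE; set M := mu * x ^+ 2.
set s := q ord0 ord_snd ord0; set a1 := a 0 ord_snd; set v1 := v 0 ord_snd.
move=> feedback muE; set p := polar _ _ _.
have -> : lam * (e - M + (p - s * (a1 + v1 * x))) - 2 * M
  = lam * (e + p) - lam * (M + s * a1) - (s * x * (lam * v1) + 2 * M) by ring.
by rewrite feedback muE; ring.
Qed.

Lemma leading_eigenvalue_expansion : 4 * e < 1 -> 0 <= mu ->
  `|lam - (1 - 2 * e)| <= 196 * (beta * x) ^+ 4.
Proof.
move=> e_small mu0; have [bx0 Bx] := (beta_x_ge0, branch_coupling_small).
have /andP[rho0 _] := damping_itv pf.
have -> : 196 * (beta * x) ^+ 4
  = 5 * (32 * (beta * x) ^+ 4) + 36 * ((beta * x) ^+ 2) ^+ 2 by ring.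
apply: eigenvalue_expansion eigenvector_critical leading_eigenvalue_equation.
- have e0 := e_ge0; move: lam_near; rewrite ler_norml => /andP[lam_ge lam_le].
  by apply/andP; split; lra.
- by rewrite mulr_ge0 ?sqr_ge0 // exprMn ler_wpM2r ?sqr_ge0 // saturation_le.
- have y1 : 8 * (beta * x) < 1 by rewrite mulrA.
  move: bx0 y1; set y := beta * x => y0 y1.
  have -> : 32 * y ^+ 4 = 32 * y ^+ 2 * y ^+ 2 by ring.
  by rewrite ler_piMl ?sqr_ge0 // expr2; nra.
- apply: le_trans branch_distance _; rewrite -exprMn.
  have := exprn_ge0 4 bx0; lra.
Qed.

Lemma branch_dominant_eigenvalue (z : R[i]) :
  eigenvalue (map_mx (real_complex R) (diag_mx d + coupling_jac q a)) z ->
  z != real_complex R lam -> `|z| < real_complex R ((1 + rho) / 2).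
Proof.
move=> z_eigen; have gap0 := damping_gap_gt0.
have half_real : real_complex R ((1 + rho) / 2) \is Num.real.
  by apply/complex_realP; eexists.
have [z_ge|//] := real_leP half_real (normr_real z); case/eqP.
pose toC := map_mx (real_complex R).
have JE : toC _ _ (diag_mx d + coupling_jac q a)
    = diag_mx (toC _ _ d) + toC _ _ (coupling_jac q a).
  by rewrite /toC map_mxD map_diag_mx.
rewrite -/(toC _ _ _) JE in z_eigen.
apply: (dominant_eigenvalue_unique (u := toC _ _ v)
  (delta := real_complex R (2 * B * x)) (gap := real_complex R ((1 - rho) / 2))
  _ _ _ _ _ _ z_eigen).
- move=> k; under eq_bigr do rewrite mxE normr_real_complex.
  by rewrite -rmorph_sum lecR coupling_jac_branch_le.
- rewrite -(rmorph_nat (real_complex R)) -rmorphM ltcR.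
  by have := branch_coupling_small; lra.
- by rewrite -JE -map_mxM v_eigen map_mxZ.
- by rewrite mxE v_critical rmorph1.
- apply: mx_norm_le => // i k; rewrite (ord1 i) mxE normr_real_complex.
  by rewrite -(rmorph1 (real_complex R)) lecR.
- move=> k k0; apply: le_trans (lerB_dist _ _); rewrite lerBrDr mxE.
  apply: le_trans z_ge; rewrite normr_real_complex -rmorphD lecR.
  by have := damped_rate pf k0; lra.
Qed.

Lemma branch_leading_eigenvalue :
  leading_eigenvalue (map_mx (real_complex R) (diag_mx d + coupling_jac q a))
    (real_complex R lam).
Proof.
split=> [|w w_eigen w_lam].
  apply/eigenvalueP; exists (map_mx (real_complex R) v).
    by rewrite -map_mxM v_eigen map_mxZ.
  apply/eqP => /rowP/(_ ord0); rewrite !mxE v_critical rmorph1 => /eqP.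
  by rewrite oner_eq0.
apply: lt_trans (branch_dominant_eigenvalue w_eigen w_lam) _.
have /andP[rho0 rho1] := damping_itv pf; have lam_gt := leading_eigenvalue_gt.
by rewrite normr_real_complex ltcR gtr0_norm; lra.
Qed.

End LeadingEigenvector.

End BranchLinearization.

Theorem pitchfork_bifurcation :
  let K := pitchfork_const beta mu in
  0 < e -> 0 < mu -> K * e < 1 ->
  exists (a : 'rV[R]_N) (lam : R),
  [/\ quad_map d q a = a,
      0 < a 0 ord0 /\ `|e - mu * a 0 ord0 ^+ 2| <= K * e ^+ 2,
      0 < lam < 1 /\ `|lam - (1 - 2 * e)| <= K * e ^+ 2
    & leading_eigenvalue
        (map_mx (real_complex R) (diag_mx d + coupling_jac q a))
        (real_complex R lam)].
Proof.
move=> K e0 mu0 Ke; have beta0 := slaving_const_ge0.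
have [a [x [a_fix ax a_le x0 x2]]] := pitchfork_branch e0 mu0 Ke.
have x_small := amplitude_small beta0 e0 mu0 saturation_le Ke (ltW x0) x2.
have [lam [v [vJ v0 v1 lam_near]]] :=
  branch_eigenpair_exists a_le x0 x_small (ltW e0).
have x4 : (beta * x) ^+ 4 <= 4 * (beta ^+ 4 * e ^+ 2 / mu ^+ 2).
  have -> : 4 * (beta ^+ 4 * e ^+ 2 / mu ^+ 2)
      = beta ^+ 4 * (2 * (e / mu)) ^+ 2.
    by field; rewrite gt_eqF.
  have -> : (beta * x) ^+ 4 = beta ^+ 4 * (x ^+ 2) ^+ 2 by ring.
  rewrite ler_wpM2l ?exprn_ge0 //.
  by rewrite ler_pXn2r ?nnegrE ?exprn_ge0 ?(ltW x0) // (le_trans _ x2) ?sqr_ge0.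
have KE : K * e ^+ 2 = 196 * (4 * (beta ^+ 4 * e ^+ 2 / mu ^+ 2)).
  by rewrite /K /pitchfork_const; field; rewrite gt_eqF.
have lam_exp : `|lam - (1 - 2 * e)| <= K * e ^+ 2.
  apply: le_trans (leading_eigenvalue_expansion a_fix ax a_le x0 x_small
    (ltW e0) vJ v0 v1 lam_near _ (ltW mu0)) _.
    exact: distance_small e0 mu0 saturation_le Ke.
  by rewrite KE ler_wpM2l ?ler0n.
exists a, lam; split=> //.
- rewrite ax; split=> //; rewrite KE.
  apply: le_trans (branch_distance a_fix ax a_le x0) _; rewrite -exprMn.
  by have := exprn_ge0 4 (mulr_ge0 beta0 (ltW x0)); lra.
- have Ke2 : K * e ^+ 2 < e by rewrite expr2 mulrA gtr_pMl.
  have /andP[rho0 _] := damping_itv pf.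
  have lam_gt := leading_eigenvalue_gt x_small (ltW e0) lam_near.
  by split=> //; move: lam_exp; rewrite ler_norml; lra.
- exact: (branch_leading_eigenvalue a_le x_small (ltW e0) vJ v0 v1 lam_near).
Qed.

End Pitchfork.

(** * The truncated Boltzmann system *)

Section SincValues.
Variable R : realType.
Implicit Types u : R.

Lemma sin_natpi k : sin (pi * k%:R : R) = 0.
Proof.
by rewrite mulr_natr -[_ *+ k]add0r (alternatingn (@sinDpi R)) sin0 mulr0.
Qed.

Lemma Gam0 : Gam 0 = 1 :> R.
Proof. by rewrite /Gam eqxx. Qed.

Lemma Gam_nat k : (0 < k)%N -> Gam k%:R = 0 :> R.
Proof. by move=> k0; rewrite /Gam pnatr_eq0 gtn_eqF // sin_natpi mul0r. Qed.

Lemma Gam_half : Gam (1 / 2) = 2 / pi :> R.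
Proof.
rewrite /Gam mul1r invr_eq0 pnatr_eq0 /= sin_pihalf mul1r invfM invrK.
by rewrite mulrC.
Qed.

Lemma Gam_three_halves : Gam (3 / 2) = - (2 / (3 * pi)) :> R.
Proof.
have pi0 := pi_gt0 R; rewrite /Gam mulf_eq0 invr_eq0 !pnatr_eq0 /=.
have -> : pi * (3 / 2) = pi / 2 + pi :> R by field.
by rewrite sinDpi sin_pihalf; field; lra.
Qed.

Lemma Gam_decay u : 2 * `|u| * `|Gam u| <= 1.
Proof.
have [->|u0] := eqVneq u 0; first by rewrite normr0 mulr0 mul0r.
have piu : 0 < pi * `|u| by rewrite mulr_gt0 ?pi_gt0 ?normr_gt0.
rewrite /Gam (negPf u0) normrM normfV normrM (ger0_norm (pi_ge0 R)) mulrA.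
rewrite ler_pdivrMr // mul1r -[leRHS]mulr1.
by apply: ler_pM => //; [rewrite ler_wpM2r ?pi_ge2 | exact: sin_max].
Qed.

Lemma Gam_half_int_le1 (i k : nat) : `|Gam (i%:R - k%:R / 2 : R)| <= 1.
Proof.
have -> : i%:R - k%:R / 2 = ((i.*2)%:Z - k%:Z)%:~R / 2 :> R.
  by rewrite rmorphB /= -muln2 !pmulrn PoszM rmorphM /=; field.
have [->|ik] := eqVneq ((i.*2)%:Z - k%:Z) 0; first by rewrite mul0r Gam0 normr1.
apply: le_trans (Gam_decay ((i.*2%:Z - k%:Z)%:~R / 2)).
rewrite ler_peMl // normrM (@ger0_norm _ 2^-1) ?invr_ge0 //.
rewrite mulrCA divff // mulr1.
by rewrite -intr_norm ler1z; lia.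
Qed.

Lemma Gam_nat_half_le (k : nat) : (1 < k)%N -> `|Gam (k%:R / 2 : R)| <= 3^-1.
Proof.
rewrite leq_eqVlt => /predU1P[<-|k3].
  by rewrite divff // (@Gam_nat 1) // normr0 invr_ge0.
have := Gam_decay (k%:R / 2); rewrite ger0_norm ?divr_ge0 //.
rewrite mulrCA divff // mulr1 => kGam.
rewrite -[leRHS]mul1r ler_pdivlMr // mulrC; apply: le_trans kGam.
by rewrite ler_wpM2r // ler_nat.
Qed.

End SincValues.

Section TruncatedSystem.
Variables (R : realType) (n : nat) (c : nat -> R).
Implicit Types v : 'rV[R]_n.

Definition diag_coef : 'rV[R]_n :=
  \row_k (2 * c k.+1 * Gam (k.+1%:R / 2)).

(* Indices are shifted by one: entry (i, j) of the k-th matrix is the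
   coefficient of [a_(i+1) a_(j+1)] in the equation for [a_(k+1)]. *)
Definition quad_coef (k : 'I_n) : 'M[R]_n :=
  \matrix_(i, j) (c k.+1 * Gam (i.+1%:R - k.+1%:R / 2)
    * ((i.+1 + j.+1 == k.+1)%N%:R + 2 * (i.+1 == k.+1 + j.+1)%N%:R)).

Lemma coef_of_ord v (i : 'I_n) : coef_of v i.+1 = v 0 i.
Proof. by rewrite /coef_of /= valK. Qed.

Lemma coef_of_gt v k : (n < k)%N -> coef_of v k = 0.
Proof. by case: k => // k kn; rewrite /coef_of insubF //; lia. Qed.

Lemma trunc_coef_of v : trunc_vec n (coef_of v) = v.
Proof. by apply/rowP => i; rewrite mxE coef_of_ord. Qed.

Lemma coef_of_sum v m k :
  \sum_(j < n) (j.+1 + m == k)%N%:R * v 0 j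
    = if (m < k)%N then coef_of v (k - m) else 0.
Proof.
case: ifP => mk; last first.
  by apply: big1 => j _; rewrite (_ : _ == k = false) ?mul0r //; lia.
have [kn|kn] := ltnP n (k - m).
  rewrite coef_of_gt // big1 // => j _; rewrite (_ : _ == k = false) ?mul0r //.
  by have := ltn_ord j; lia.
have i_lt : ((k - m).-1 < n)%N by lia.
have -> : (k - m)%N = (Ordinal i_lt).+1 by rewrite /=; lia.
rewrite coef_of_ord (bigD1 (Ordinal i_lt)) //= (_ : _ == k); last by lia.
rewrite mul1r big1 ?addr0 // => j; rewrite -val_eqE /= => ji.
by rewrite (_ : _ == k = false) ?mul0r //; lia.
Qed.

Lemma QmapE : @Qmap R n c = quad_map diag_coef quad_coef.
Proof.
apply/funext => v; apply/rowP => k.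
rewrite [LHS]mxE [RHS]mxE; cbv beta zeta.
rewrite coef_of_ord -addrA [diag_coef _ _]mxE; congr (_ + _).
rewrite (@big_nat_widen _ _ _ 1 k.+1 n.+1) //; last by have := ltn_ord k; lia.
rewrite (@big_nat_widenl _ _ _ k.+2 1 n.+1) //.
rewrite !big_add1 !big_mkord [in X in _ * X + _]big_mkcond.
rewrite [in X in _ + _ * X]big_mkcond !mulr_sumr -big_split.
rewrite /bform -(pair_bigA _ (fun i j => quad_coef k i j * (v 0 i * v 0 j))).
apply: eq_bigr => i _; rewrite !andTb !(coef_of_ord v i).
pose w := c k.+1 * Gam (i.+1%:R - k.+1%:R / 2) * v 0 i.
rewrite (eq_bigr (fun j : 'I_n => w * ((j.+1 + i.+1 == k.+1)%N%:R * v 0 j)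
    + 2 * w * ((j.+1 + k.+1 == i.+1)%N%:R * v 0 j))); last first.
  move=> j _; rewrite mxE (addnC i.+1) (addnC k.+1) [i.+1 == _]eq_sym /w.
  by ring.
rewrite big_split -!mulr_sumr !coef_of_sum.
congr (_ + _); case: ifP => _; rewrite ?mulr0 // /w; ring.
Qed.

End TruncatedSystem.

Section NoiseSystem.
Variable R : realType.

Lemma tail_sum_coef_of n (v : 'rV[R]_n) k :
  \forall p \near \oo, \sum_(k.+1 <= i < p) tail_term (coef_of v) k i
    = \sum_(k.+1 <= i < n.+1) tail_term (coef_of v) k i.
Proof.
near=> p; have np : (n.+1 <= p)%N by near: p; exact: nbhs_infty_ge.
have tail0 i : (n < i)%N -> tail_term (coef_of v) k i = 0.
  by move=> ni; rewrite /tail_term coef_of_gt // mulr0 mul0r.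
have [kn|nk] := leqP k.+1 n.+1.
  rewrite (@big_cat_nat _ _ _ n.+1 k.+1 p) //= [X in _ + X]big_nat_cond.
  by rewrite [X in _ + X]big1 ?addr0 // => i; rewrite andbT => /andP[/tail0].
rewrite [RHS]big_geq 1?ltnW // big_nat_cond big1 // => i.
by rewrite andbT => /andP[ki _]; apply: tail0; lia.
Unshelve. all: by end_near. Qed.

Lemma stationary_coef_of n (c : nat -> R) (v : 'rV[R]_n) :
  (forall k, (n < k)%N -> c k = 0) -> Qmap c v = v -> stationary c (coef_of v).
Proof.
move=> c0 vE; split=> // k k1; have tailE := tail_sum_coef_of v k.
split; first exact: is_cvg_near_cst tailE.
rewrite /boltzmann_rhs (@lim_near_cst _ (@Rhausdorff R) _ _ _ _ _ tailE) //.
have [kn|nk] := leqP k n; last first.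
  by rewrite c0 // coef_of_gt // !(mulr0, mul0r) oppr0 !addr0.
have k1n : (k.-1 < n)%N by lia.
have /rowP/(_ (Ordinal k1n)) := vE; rewrite mxE -coef_of_ord; cbv beta zeta.
have -> : (Ordinal k1n).+1 = k by rewrite /= prednK.
by move/eqP; rewrite -subr_eq0 => /eqP vk; rewrite -[RHS]vk /tail_term; ring.
Qed.

Lemma jacobianQE n (c : nat -> R) (v : 'rV[R]_n) :
  jacobianQ n c (coef_of v) = map_mx (real_complex R)
    (diag_mx (diag_coef n c) + coupling_jac (quad_coef (n := n) c) v).
Proof. by rewrite /jacobianQ trunc_coef_of QmapE jacobian_quad_map. Qed.

Lemma quad_coef_l1norm n (c : nat -> R) (k : 'I_n) : `|c k.+1| <= 1 ->
  l1norm (quad_coef c k) <= 2 * n%:R ^+ 2.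
Proof.
move=> ck; apply: (@le_trans _ _ (\sum_(p : 'I_n * 'I_n) 2)); last first.
  by rewrite sumr_const card_prod !card_ord expr2 -natrM mulr_natr.
apply: ler_sum => -[i j] _; rewrite mxE 2!normrM -[leRHS]mul1r.
apply: ler_pM => //.
  by rewrite -[leRHS]mul1r ler_pM // Gam_half_int_le1.
case: (eqVneq (i.+1 + j.+1)%N k.+1) => ijk.
  by rewrite (_ : _ == _ = false) /= ?mulr0 ?addr0 ?normr1 ?ler1n //; lia.
by case: eqVneq => _ /=; rewrite ?mulr0 ?mulr1 ?add0r ?normr0 ?ger0_norm.
Qed.

Lemma quad_coef_neq0 n (c : nat -> R) (k i j : 'I_n) :
  quad_coef c k i j != 0 ->
  (i.+1 + j.+1 = k.+1)%N \/ (i.+1 = k.+1 + j.+1)%N.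
Proof.
rewrite mxE; case: (eqVneq (i.+1 + j.+1)%N k.+1) => [|_]; first by left.
case: (eqVneq i.+1 (k.+1 + j.+1)%N) => [|_]; first by right.
by rewrite /= mulr0 addr0 mulr0 eqxx.
Qed.

Section NoisePitchfork.
Variables (n : nat) (c : nat -> R) (e : R).
Local Notation N := n.+2.
Hypothesis c_le1 : forall k, (0 < k)%N -> `|c k| <= 1.
Hypothesis c1E : c 1%N = pi / 4 * (1 + e).

Lemma noise_pitchfork : pitchfork (2 / 3) (2 * N%:R ^+ 2) e
  (diag_coef N c) (quad_coef (n := N) c).
Proof.
have pi0 := pi_gt0 R; split.
- by apply/andP; split; lra.
- by rewrite mxE /= Gam_half c1E; field; lra.
- by rewrite mxE /= divff // (@Gam_nat R 1) // mulr0.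
- move=> k k0; rewrite mxE !normrM (@ger0_norm _ 2) // -mulrA ler_pM2l //.
  rewrite -[leRHS]mul1r ler_pM ?c_le1 ?Gam_nat_half_le //.
  by case: k k0 => -[].
- by move=> k; apply: quad_coef_l1norm; exact: c_le1.
- move=> i j /quad_coef_neq0[/= |]; first by lia.
  rewrite add1n => -[ij]; have [j0|j0] := eqVneq j ord0; [left|right].
    by rewrite j0; congr pair; apply: val_inj; rewrite /= ij j0.
  by split=> //; rewrite ij ltnS lt0n; move: j0; rewrite -val_eqE.
- move=> i j q_neq0.
  have [ij|i3] : (i.+1 + j.+1 = 2)%N \/ (i.+1 = 2 + j.+1)%N
    := quad_coef_neq0 q_neq0.
    by congr pair; apply: val_inj => /=; lia.
  move: q_neq0; rewrite mxE i3 (_ : (ord_snd n).+1 = 2%N) // divff //.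
  by rewrite -[X in X - 1]natr1 addrK Gam_nat // mulr0 mul0r eqxx.
- move=> k k1; apply/eqP; apply: contraTT k1 => /quad_coef_neq0 /=; lia.
Qed.

Lemma noise_saturation :
  saturation (quad_coef (n := N) c) = (1 + e) * c 2%N / 3.
Proof.
have pi0 := pi_gt0 R; rewrite /saturation !mxE /= c1E.
rewrite (_ : 2 - 1 / 2 = 3 / 2); last by field.
by rewrite Gam_three_halves divff // subrr Gam0; field; lra.
Qed.

End NoisePitchfork.

End NoiseSystem.

Section UniformDistribution.
Variable R : realType.
Implicit Type c : nat -> R.

Lemma uniform_coefE n : @uniform_coef R = coef_of (0 : 'rV[R]_n).
Proof.
apply/funext => -[|k]; rewrite /uniform_coef //=.
by case: insubP => // i _ _; rewrite mxE.
Qed.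

Lemma uniform_stationary n c :
  (forall k, (n < k)%N -> c k = 0) -> stationary c (@uniform_coef R).
Proof.
move=> c0; rewrite (uniform_coefE n); apply: stationary_coef_of => //.
by rewrite QmapE; apply/rowP => k; rewrite mxE bform0 !mxE mulr0 addr0.
Qed.

Lemma uniform_stableP c : (forall k, (1 < k)%N -> `|c k| <= 1) ->
  uniform_stable c <-> c 1%N <= pi / 4.
Proof.
move=> c_le1; have pi0 := pi_gt0 R.
have rate1 : (uniform_rate c 1 <= 0) = (c 1%N <= pi / 4).
  rewrite /uniform_rate Gam_half subr_le0 mulrA ler_pdivrMr // mul1r.
  by rewrite ler_pdivlMr //; congr (_ <= _); ring.
split=> [/(_ 1%N isT)|c1 k]; first by rewrite rate1.
rewrite leq_eqVlt => /predU1P[<-|k1]; first by rewrite rate1.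
rewrite subr_le0 -mulrA.
have := ler_pM (normr_ge0 _) (normr_ge0 _) (c_le1 k k1) (Gam_nat_half_le R k1).
by rewrite -normrM ler_norml; lra.
Qed.

End UniformDistribution.

(** * The branch near the critical parameter *)

Definition stable_branch (R : realType) N (c a : nat -> R) (lam : R) : Prop :=
  [/\ stationary c a, a <> @uniform_coef R, (forall k, (N < k)%N -> a k = 0),
      linearly_stable N c a
    & leading_eigenvalue (jacobianQ N c a) (real_complex R lam)].

Definition noise_const (R : realType) n (m : R) : R :=
  pitchfork_const (slaving_const (2 / 3) (2 * n.+2%:R ^+ 2)) (m / 3).

Lemma noise_const_ge0 (R : realType) n (m : R) : 0 <= noise_const n m.
Proof. exact: sqr_ge0. Qed.

Lemma noise_bifurcation (R : realType) n (c : nat -> R) (m e : R) :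
  (forall k, (0 < k)%N -> `|c k| <= 1) -> (forall k, (n.+2 < k)%N -> c k = 0) ->
  c 1%N = pi / 4 * (1 + e) -> 0 < m <= c 2%N ->
  0 < e -> noise_const n m * e < 1 ->
  exists (a : nat -> R) (lam : R),
  [/\ stable_branch n.+2 c a lam, 0 < a 1%N,
      `|e - (1 + e) * c 2%N / 3 * a 1%N ^+ 2| <= noise_const n m * e ^+ 2
    & `|lam - (1 - 2 * e)| <= noise_const n m * e ^+ 2].
Proof.
move=> c_le1 c0 c1E /andP[m0 mc] e0 Ke.
have c2_gt0 := lt_le_trans m0 mc; have pf := noise_pitchfork n c_le1 c1E.
set K := pitchfork_const (slaving_const (2 / 3) (2 * n.+2%:R ^+ 2))
  ((1 + e) * c 2%N / 3).
have KM : K <= noise_const n m.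
  apply: pitchfork_const_antitone.
  rewrite divr_gt0 //= ler_pM2r ?invr_gt0 //; apply: le_trans mc _.
  by rewrite ler_peMl ?lerDl ?(ltW c2_gt0) ?(ltW e0).
have [||v [lam [v_fix]]] := pitchfork_bifurcation pf e0.
- by rewrite (noise_saturation n c1E) divr_gt0 ?mulr_gt0 ?addr_gt0.
- rewrite (noise_saturation n c1E); apply: le_lt_trans Ke.
  by rewrite ler_wpM2r // ltW.
rewrite -QmapE in v_fix; rewrite (noise_saturation n c1E) -/K -jacobianQE.
move=> [v0 v_amp] [/andP[lam0 lam1] lam_exp] [lead lead_max].
have Ke2 : K * e ^+ 2 <= noise_const n m * e ^+ 2 by rewrite ler_wpM2r ?sqr_ge0.
have v1 : coef_of v 1%N = v 0 ord0 := coef_of_ord v ord0.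
exists (coef_of v), lam; rewrite v1; split=> //; first split.
- exact: stationary_coef_of.
- move=> /(congr1 (@^~ 1%N)); rewrite v1 /uniform_coef /= => v_eq0.
  by rewrite v_eq0 ltxx in v0.
- by move=> k; exact: coef_of_gt.
- have lam_lt1 : `|real_complex R lam| < 1.
    by rewrite normr_real_complex -(rmorph1 (real_complex R)) ltcR gtr0_norm.
  move=> z z_eigen; have [->//|z_lam] := eqVneq z (real_complex R lam).
  exact: lt_trans (lead_max z z_eigen z_lam) lam_lt1.
- by [].
- exact: le_trans v_amp Ke2.
- exact: le_trans lam_exp Ke2.
Qed.

Lemma sqr_le_mul_sqrt (R : rcfType) (x : R) :
  0 <= x <= 1 -> x ^+ 2 <= x * Num.sqrt x.
Proof.
move=> /andP[x0 x1]; rewrite expr2 ler_wpM2l // -[leLHS](sqr_sqrtr x0) expr2.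
by rewrite ler_piMl ?sqrtr_ge0 // -[leRHS]sqrtr1 ler_wsqrtr.
Qed.

Lemma sqrt_dist_le (R : rcfType) (x w : R) : 0 <= x -> 0 < w ->
  `|x - Num.sqrt w| <= `|x ^+ 2 - w| / Num.sqrt w.
Proof.
move=> x0 w0; have r0 : 0 < Num.sqrt w by rewrite sqrtr_gt0.
rewrite ler_pdivlMr // -[in X in _ <= X](sqr_sqrtr (ltW w0)) subr_sqr normrM.
by rewrite ler_wpM2l // ger0_norm ?addr_ge0 ?(ltW r0) // lerDr.
Qed.

Lemma amplitude_expansion (R : rcfType) (e c kap x m K L : R) :
  0 < e -> 0 < m <= c -> c <= 1 -> 0 < kap <= 1 -> 0 < x ->
  `|e - (1 + e) * c / 3 * x ^+ 2| <= K * e ^+ 2 -> `|c - kap| <= L * e ->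
  `|x - Num.sqrt (3 * (e / kap))|
    <= 3 / m * (K + (L + 1) / kap) * (e * Num.sqrt e).
Proof.
move=> e0 /andP[m0 mc] c1 /andP[kap0 kap1] x0 x_amp c_kap.
set w := 3 * (e / kap); pose s := (1 + e) * c / 3.
have w0 : 0 < w by rewrite mulr_gt0 // divr_gt0.
have ew : e <= w.
  by rewrite /w mulrA ler_pdivlMr //; have := ler_wpM2l (ltW e0) kap1; lra.
have m3 : m / 3 <= s.
  rewrite ler_pM2r ?invr_gt0 //.
  by have := mulr_gt0 e0 (lt_le_trans m0 mc); lra.
have w_defect : `|e - s * w| <= (L + 1) / kap * e ^+ 2.
  have -> : e - s * w = e * ((kap - c - e * c) / kap).
    by rewrite /s /w; field; rewrite gt_eqF.
  have -> : (L + 1) / kap * e ^+ 2 = e * ((L * e + 1 * e) / kap).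
    by field; rewrite gt_eqF.
  rewrite !normrM (gtr0_norm e0) ler_pM2l // normfV (gtr0_norm kap0).
  rewrite ler_pM2r ?invr_gt0 // (le_trans (ler_normB _ _)) // distrC lerD //.
  by rewrite gtr0_norm ?mulr_gt0 // ?(lt_le_trans m0) // mulrC ler_wpM2r // ltW.
have xw : m / 3 * `|x ^+ 2 - w| <= (K + (L + 1) / kap) * e ^+ 2.
  apply: (@le_trans _ _ (s * `|x ^+ 2 - w|)); first by rewrite ler_wpM2r.
  have -> : s * `|x ^+ 2 - w| = `|(e - s * w) - (e - s * x ^+ 2)|.
    rewrite -[s in LHS]gtr0_norm; last first.
      by apply: lt_le_trans m3; rewrite divr_gt0.
    by rewrite -normrM; congr `|_|; ring.
  apply: le_trans (ler_normB _ _) _; rewrite mulrDl addrC; exact: lerD.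
apply: le_trans (sqrt_dist_le (ltW x0) w0) _.
set D := K + _ in xw *.
set r := Num.sqrt e; have r0 : 0 < r by rewrite sqrtr_gt0.
have D0 : 0 <= D.
  rewrite -(pmulr_lge0 _ (exprn_gt0 2 e0)); apply: le_trans xw.
  by rewrite mulr_ge0 // divr_ge0 // ltW.
rewrite ler_pdivrMr ?sqrtr_gt0 //.
apply: (@le_trans _ _ (3 / m * (D * e ^+ 2))).
  by rewrite mulrAC ler_pdivlMr // mulrC -ler_pdivrMl // mulrA [_^-1 * _]mulrC.
have -> : 3 / m * D * (e * r) * Num.sqrt w
    = 3 / m * (D * (e * (r * Num.sqrt w))) by ring.
rewrite ler_wpM2l ?divr_ge0 ?(ltW m0) // ler_wpM2l // expr2 ler_pM2l //.
by rewrite -[leLHS](sqr_sqrtr (ltW e0)) expr2 ler_pM2l // ler_wsqrtr.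
Qed.

Lemma deriv_on_right_lipschitz (R : realType) (f f' : R -> R) (a b p : R) :
  a <= p < b -> deriv_on a b f f' ->
  exists2 L, 0 < L & \forall x \near p^'+, `|f x - f p| <= L * (x - p).
Proof.
move=> /andP[ap pb] /(_ p); rewrite ap ltW // => /(_ isT) /cvgrPdist_le /=.
move=> /(_ 1 ltr01); rewrite near_withinE => -[r /= r0 f_diff].
exists (1 + `|f' p|); first by rewrite ltr_pwDl.
near=> x; have px : 0 < x - p.
  by rewrite subr_gt0; near: x; exact: nbhs_right_gt.
have xr : x - p < r by near: x; exact: nbhs_right_ltDr.
have xb : x <= b by near: x; exact: nbhs_right_le.
have := f_diff (x - p); rewrite /ball_ /= sub0r normrN gtr0_norm //.
rewrite [p + _]addrC subrK.
have ax : a <= x by rewrite (le_trans ap) // -subr_ge0 ltW.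
rewrite gt_eqF // ax xb => /(_ xr isT isT) f'_dist.
rewrite -ler_pdivrMr // -[X in _ / X](gtr0_norm px).
rewrite -normfV -normrM mulrC.
have := ler_normB (f' p) (f' p - (x - p)^-1 * (f x - f p)).
by rewrite opprB addrC subrK; lra.
Unshelve. all: by end_near. Qed.

Lemma near_right_choice (R : realType) (T : pointedType) (p b : R)
    (P : R -> T -> Prop) :
  p < b -> (\forall x \near p^'+, exists t, P x t) ->
  exists2 r, p < r <= b & exists f, forall x, p < x < r -> P x (f x).
Proof.
move=> pb [e /= e0 eP]; exists (Num.min (p + e) b).
  by rewrite lt_min ltrDl e0 pb ge_min lexx orbT.
exists (fun x => get (P x)) => x /andP[px]; rewrite lt_min => /andP[xe _].
have x_near : ball_ Num.norm p e x.
  by rewrite /= ltr0_norm ?subr_lt0 // opprB ltrBlDl.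
by have [t Pt] := eP x x_near px; exact: getPex (ex_intro _ t Pt).
Qed.

Lemma eqO_near_le (T : Type) (F : filter_on T) (R : realFieldType)
    (V W : normedModType R) (f : T -> V) (h : T -> W) (C : R) :
  (\forall x \near F, `|f x| <= C * `|h x|) -> f =O_F h.
Proof.
move=> fCh; apply/eqO_exP; exists (`|C| + 1); first by rewrite ltr_wpDl.
apply: filterS fCh => x /le_trans; apply.
by rewrite ler_wpM2r // (le_trans (ler_norm C)) // lerDl.
Qed.

Lemma powR_three_halves (R : realType) (x : R) :
  0 < x -> x `^ (3 / 2) = x * Num.sqrt x.
Proof.
move=> x0; rewrite (_ : 3 / 2 = 1 + 2^-1); last by field.
by rewrite powRD ?gt_eqF ?implybT // powRr1 ?ltW // powR12_sqrt ?ltW.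
Qed.

Lemma noise_coef_le1 (R : realType) N (gam : nat -> R -> R) g1 k :
  0 <= g1 <= 1 -> (forall l, (2 <= l <= N)%N -> -1 <= gam l g1 <= 1) ->
  (0 < k)%N -> `|noise_coef N gam g1 k| <= 1.
Proof.
move=> /andP[g0 g11] gam_le; rewrite /noise_coef; case: k => [//|[_|k _]] /=.
  by rewrite ger0_norm.
by case: ifP => kN; rewrite ?normr0 // ler_norml gam_le.
Qed.

Lemma noise_coef_gt (R : realType) N (gam : nat -> R -> R) g1 k :
  (0 < N)%N -> (N < k)%N -> noise_coef N gam g1 k = 0.
Proof.
move=> N0 Nk; rewrite /noise_coef ifN; last by lia.
by rewrite !ifN //; lia.
Qed.

Section SupercriticalBranch.
Variables (R : realType) (n : nat) (gam : nat -> R -> R) (gam2' : R -> R).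
Local Notation N := n.+2.
Local Notation kap := (gam 2%N (pi / 4)).
Hypothesis gam_le1 : forall k g1,
  (2 <= k <= N)%N -> 0 <= g1 <= 1 -> -1 <= gam k g1 <= 1.
Hypothesis kap_gt0 : 0 < kap.
Hypothesis gam2_deriv : deriv_on 0 1 (gam 2%N) gam2'.

Lemma pi_lt4 : pi < 4 :> R.
Proof. by have := @pihalf_lt2 R; lra. Qed.

Definition approximates_branch (C g1 : R) (p : (nat -> R) * R) : Prop :=
  let err := C * `|(g1 - pi / 4) `^ (3 / 2)| in
  [/\ stable_branch N (noise_coef N gam g1) p.1 p.2,
      `|p.1 1%N - Num.sqrt (12 * (g1 - pi / 4) / (pi * kap))| <= err
    & `|p.2 - (1 - 8 / pi * (g1 - pi / 4))| <= err].

Local Notation K := (noise_const n (kap / 2)).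

Definition amplitude_const (L : R) : R := 3 / (kap / 2) * (K + (L + 1) / kap).

Definition branch_error_const (L : R) : R :=
  (amplitude_const L + K) * (4 / pi) `^ (3 / 2).

Lemma amplitude_const_ge0 L : 0 <= L -> 0 <= amplitude_const L.
Proof.
move=> L0; rewrite /amplitude_const mulr_ge0 ?addr_ge0 ?noise_const_ge0 //.
  by rewrite !divr_ge0 // ltW.
by rewrite divr_ge0 ?addr_ge0 // ltW.
Qed.

Lemma supercritical_branch L g1 e : 0 <= L -> e = 4 / pi * (g1 - pi / 4) ->
  0 < e < 1 -> g1 <= 1 -> K * e < 1 -> L * e < kap / 2 ->
  `|gam 2%N g1 - kap| <= L * e ->
  exists p, approximates_branch (branch_error_const L) g1 p.
Proof.
move=> L0 eE /andP[e0 e1] g1_le1 Ke Le c2_kap; have pi0 := pi_gt0 R.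
have g1E : g1 - pi / 4 = pi / 4 * e by rewrite eE; field; lra.
have g1_gt : 0 < g1 - pi / 4 by rewrite g1E mulr_gt0 ?divr_gt0.
have g1_itv : 0 <= g1 <= 1 by apply/andP; split; lra.
set c := noise_coef N gam g1.
have c_le1 k : (0 < k)%N -> `|c k| <= 1.
  by apply: noise_coef_le1 => // l lN; exact: gam_le1.
have c_gt k : (N < k)%N -> c k = 0 by exact: noise_coef_gt.
have c2_le1 : c 2%N <= 1 by have := c_le1 2%N isT; rewrite ler_norml => /andP[].
have c2_ge : 0 < kap / 2 <= c 2%N.
  have c2E : c 2%N = gam 2%N g1 by [].
  rewrite divr_gt0 //= c2E; move: c2_kap; rewrite ler_norml => /andP[c2_ge _].
  lra.
have c1E : c 1%N = pi / 4 * (1 + e) by rewrite mulrDr -g1E mulr1 addrC subrK.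
have kap_itv : 0 < kap <= 1.
  rewrite kap_gt0; have /andP[] // : -1 <= kap <= 1.
  by apply: gam_le1 => //; apply/andP; split; lra.
have [a [lam [branch a1_gt0 a1_amp lam_exp]]] :=
  noise_bifurcation c_le1 c_gt c1E c2_ge e0 Ke.
have err_E : branch_error_const L * `|(g1 - pi / 4) `^ (3 / 2)|
    = amplitude_const L * (e * Num.sqrt e) + K * (e * Num.sqrt e).
  rewrite ger0_norm ?powR_ge0 // -mulrA.
  rewrite -powRM ?divr_ge0 ?(ltW g1_gt) ?(ltW pi0) //.
  by rewrite -eE powR_three_halves // mulrDl.
have [A0 K0] := (amplitude_const_ge0 L0, noise_const_ge0 n (kap / 2)).
have err0 : 0 <= e * Num.sqrt e by rewrite mulr_ge0 ?sqrtr_ge0 ?ltW.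
exists (a, lam); split=> //=; rewrite err_E.
- have -> : 12 * (g1 - pi / 4) / (pi * kap) = 3 * (e / kap).
    by rewrite g1E; field; apply/andP; split; [rewrite gt_eqF | lra].
  apply: le_trans (amplitude_expansion e0 c2_ge c2_le1 kap_itv a1_gt0 a1_amp
    c2_kap) _.
  by rewrite lerDl mulr_ge0.
- have -> : 8 / pi * (g1 - pi / 4) = 2 * e by rewrite eE; ring.
  apply: le_trans lam_exp _; apply: ler_wpDl; first by rewrite mulr_ge0.
  by rewrite ler_wpM2l // sqr_le_mul_sqrt // !ltW.
Qed.

Lemma supercritical_branch_near : exists C, \forall g1 \near (pi / 4)^'+,
  exists p, approximates_branch C g1 p.
Proof.
have [pi0 pi4] := (pi_gt0 R, pi_lt4).
have [|L L0 gam2_lip] := deriv_on_right_lipschitz (p := pi / 4) _ gam2_deriv.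
  by apply/andP; split; lra.
have near_e r : 0 < r ->
    \forall g1 \near (pi / 4 : R)^'+, 4 / pi * (g1 - pi / 4) < r.
  move=> r0; near=> g1; rewrite -ltr_pdivlMl ?divr_gt0 //.
  by near: g1; apply: nbhs_right_ltDr; rewrite mulr_gt0 ?invr_gt0 ?divr_gt0.
have K1 : 0 < K + 1 by rewrite ltr_wpDl ?noise_const_ge0.
exists (branch_error_const L); near=> g1.
have g1_gt : 0 < g1 - pi / 4.
  by rewrite subr_gt0; near: g1; exact: nbhs_right_gt.
apply: (supercritical_branch (ltW L0) erefl).
- by rewrite mulr_gt0 ?divr_gt0 //=; near: g1; exact: near_e.
- by near: g1; apply: nbhs_right_le; lra.
- have : 4 / pi * (g1 - pi / 4) < 1 / (K + 1).
    by near: g1; apply: near_e; rewrite divr_gt0.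
  have : 0 < 4 / pi * (g1 - pi / 4) by rewrite mulr_gt0 ?divr_gt0.
  by rewrite ltr_pdivlMr //; lra.
- rewrite mulrC -ltr_pdivlMr //; near: g1; apply: near_e.
  by rewrite !divr_gt0.
- apply: (@le_trans _ _ (L * (g1 - pi / 4))); first by near: g1.
  by rewrite ler_pM2l // ler_peMl ?(ltW g1_gt) // ler_pdivlMr // mul1r ltW.
Unshelve. all: by end_near. Qed.

End SupercriticalBranch.

Theorem theorem10 (R : realType) (N : nat) (hN : (2 <= N)%N)
  (gam : nat -> R -> R) (g : R -> R -> R)
  (hg : forall g1 x : R, 0 <= g1 <= 1 -> - pi < x <= pi ->
     g g1 x = 1 + 2 * g1 * cos x
              + 2 * \sum_(2 <= k < N.+1) gam k g1 * cos (k%:R * x))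
  (hC2 : forall k : nat, (2 <= k <= N)%N -> C2_on 0 1 (gam k))
  (hbnd : forall (k : nat) (g1 : R), (2 <= k <= N)%N -> 0 <= g1 <= 1 ->
     -1 <= gam k g1 <= 1)
  (hpos : forall g1 : R, 0 <= g1 <= 1 -> 0 < gam 2%N g1) :
  [/\ (forall g1 : R, 0 <= g1 <= 1 ->
         [/\ stationary (noise_coef N gam g1) (@uniform_coef R),
             (g1 < pi / 4 -> uniform_stable (noise_coef N gam g1))
           & (pi / 4 < g1 -> uniform_unstable (noise_coef N gam g1))])
    & exists gmax : R, pi / 4 < gmax <= 1 /\
      exists (a : R -> nat -> R) (lam : R -> R),
        [/\ (forall g1 : R, pi / 4 < g1 < gmax ->
               [/\ stationary (noise_coef N gam g1) (a g1),
                   a g1 <> @uniform_coef R,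
                   (forall k : nat, (N < k)%N -> a g1 k = 0),
                   linearly_stable N (noise_coef N gam g1) (a g1)
                 & leading_eigenvalue
                     (jacobianQ N (noise_coef N gam g1) (a g1))
                     (real_complex R (lam g1))]),
            (fun g1 : R => a g1 1%N
               - Num.sqrt (12 * (g1 - pi / 4) / (pi * gam 2%N (pi / 4))))
              =O_ ((pi / 4 : R)^'+) (fun g1 : R => (g1 - pi / 4) `^ (3 / 2))
          & (fun g1 : R => lam g1 - (1 - 8 / pi * (g1 - pi / 4)))
              =O_ ((pi / 4 : R)^'+) (fun g1 : R => (g1 - pi / 4) `^ (3 / 2))]].
Proof.
case: N hN hg hC2 hbnd => [|[|n]] // _ _ hC2 hbnd.
have [pi0 pi4] := (pi_gt0 R, pi_lt4 R).
have kap_gt0 : 0 < gam 2%N (pi / 4) by apply: hpos; apply/andP; split; lra.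
split=> [g1 g1_itv|].
  have c_le1 k : (1 < k)%N -> `|noise_coef n.+2 gam g1 k| <= 1.
    by move=> /ltnW; apply: noise_coef_le1 => // l lN; exact: hbnd.
  have stableP := uniform_stableP c_le1.
  split; first by apply: uniform_stationary => k; exact: noise_coef_gt.
    by move=> g1_lt; apply/stableP; exact: ltW.
  by move=> g1_gt /stableP; rewrite leNgt g1_gt.
have [gam2' [? [gam2_deriv _ _]]] := hC2 2%N isT.
have [C /near_right_choice branch] :=
  supercritical_branch_near hbnd kap_gt0 gam2_deriv.
have [|gmax gmax_itv [F FP]] := branch 1; first lra.
have near_F : \forall g1 \near (pi / 4)^'+,
    approximates_branch n gam C g1 (F g1).
  near=> g1; apply: FP; apply/andP; split; near: g1; first exact: nbhs_right_gt.
  by apply: nbhs_right_lt; case/andP: gmax_itv.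
exists gmax; split=> //.
exists (fun g1 => (F g1).1), (fun g1 => (F g1).2); split.
- by move=> g1 /FP[].
- by apply: (@eqO_near_le _ _ _ _ _ _ _ C); apply: filterS near_F => g1 [].
- by apply: (@eqO_near_le _ _ _ _ _ _ _ C); apply: filterS near_F => g1 [].
Unshelve. all: by end_near. Qed.
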